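(* Let $G$ be a $\sigma$-compact locally compact metrizable group, $\Gamma\subset G$ a lattice, $X=G/\Gamma$, and $\mu$ a spread out Borel probability measure on $G$. Suppose that $X$ is connected or that $\mu$ is additionally adapted and aperiodic. Then for every $x_0\in X$ we have $$\|\mu^{*n}*\delta_{x_0}-m_X\|\longrightarrow 0$$ as $n\to\infty$, where $m_X$ denotes the normalized Haar measure on $X$ and $\|\cdot\|$ is the total variation norm.
   Context: A discrete subgroup $\Gamma\subset G$ is a lattice if $X=G/\Gamma$ admits a finite non-trivial $G$-invariant Radon measure; $m_X$ is the one normalized to be a probability measure. $\mu^{*n}$ is the $n$-th convolution power of $\mu$. $\mu$ is spread out if for some $n_0\in\mathbb{N}$ the measure $\mu^{*n_0}$ is not singular with respect to Haar measure on $G$. Let $\mathcal{G}$ be the closed subgroup of $G$ generated by $\operatorname{supp}(\mu)$. $\mu$ is adapted if $\mathcal{G}=G$. $\mu$ is aperiodic if $\mu$ is not supported on a coset of a proper normal open subgroup of $\mathcal{G}$ containing the commutator subgroup $[\mathcal{G},\mathcal{G}]$. $\mu^{*n}*\delta_{x_0}$ is the law of $Y_n\cdots Y_1x_0$ for i.i.d. $Y_k$ with law $\mu$. The total variation norm of a finite signed measure $\nu$ on $X$ is $\|\nu\|=\sup_{|f|\le1}|\int_X f\,d\nu|$ over measurable $f\colon X\to\mathbb{C}$ bounded by $1$. *)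

(* Defs.v *)
From HB Require Import structures.
From mathcomp Require Import all_boot all_order all_algebra complex.
From mathcomp Require Import all_classical all_reals all_analysis.
From mathcomp Require Import measurable_realfun.

Set Implicit Arguments.
Unset Strict Implicit.
Unset Printing Implicit Defensive.

Import Order.TTheory GRing.Theory Num.Theory.
Import numFieldNormedType.Exports.

Local Open Scope classical_set_scope.
Local Open Scope ring_scope.
Local Open Scope quotient_scope.

(* The distinguished point carried by [PointedTopological] is arbitrary and
   plays no mathematical role: the measure theory library requires pointed
   carriers. *)
HB.mixin Record isTopologicalGroup G & PointedTopological G & Group G := {
  mulg_continuous : continuous (fun p : G * G => (p.1 * p.2)%g) ;
  invg_continuous : continuous (fun x : G => (x^-1)%g)
}.

#[short(type="topologicalGroupType")]
HB.structure Definition TopologicalGroup :=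
  {G of PointedTopological G & Group G & isTopologicalGroup G}.

Definition sigma_compact (T : topologicalType) :=
  exists K : (set T)^nat, (forall n, compact (K n)) /\ \bigcup_n K n = setT.

Definition metrizable (R : realType) (T : topologicalType) :=
  exists d : T -> T -> R,
    [/\ forall x y, d x y = 0 <-> x = y,
        forall x y, d x y = d y x,
        forall x y z, d x z <= d x y + d y z &
        forall x (A : set T), nbhs x A <->
          exists2 e : R, 0 < e & [set y | d x y < e] `<=` A].

Definition borel (T : ptopologicalType) := g_sigma_algebraType (@open T).

(* Finite on compact sets, outer regular on Borel sets and inner
   regular on open sets. *)
Definition radon (R : realType) (T : ptopologicalType)
    (m : {measure set (borel T) -> \bar R}) :=
  [/\ forall K : set T, compact K -> (m K < +oo)%E,
      forall A : set (borel T), measurable A ->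
        m A = ereal_inf [set m U | U in [set U : set T | open U /\ A `<=` U]] &
      forall U : set T, open U ->
        m U = ereal_sup [set m K | K in [set K : set T | compact K /\ K `<=` U]]].

Definition invariant (R : realType) (G : Type) (T : ptopologicalType)
    (act : G -> T -> T) (m : {measure set (borel T) -> \bar R}) :=
  forall g (A : set (borel T)), measurable A -> m (act g @^-1` A) = m A.

Definition haar (R : realType) (G : topologicalGroupType)
    (m : {measure set (borel G) -> \bar R}) :=
  [/\ radon m, m setT <> 0%E & invariant (fun g h : G => (g * h)%g) m].

Definition mutually_singular d (T : measurableType d) (R : realType)
    (m1 m2 : {measure set T -> \bar R}) :=
  exists A : set T, [/\ measurable A, m1 A = 0%E & m2 (~` A) = 0%E].

Section convolution.
Context (R : realType) (G : topologicalGroupType) (X : ptopologicalType).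
Context (act : G -> X -> X).
Hypothesis metG : metrizable R G.
Hypothesis act_cts : continuous (fun p : G * X => act p.1 p.2).

Let act_open g (A : set X) : open A -> open (act g @^-1` A).
Proof.
move: A; apply/continuousP => x.
apply: (@continuous_comp _ _ _ (pair g) (fun p : G * X => act p.1 p.2)).
  by apply: cvg_pair; [exact: cvg_cst|exact: cvg_id].
exact: act_cts.
Qed.

Let act_measurable g (A : set (borel X)) :
  measurable A -> measurable (act g @^-1` A : set (borel X)).
Proof.
move=> mA; rewrite -[_ @^-1` _]setTI.
apply: (@measurability _ _ (borel X) (borel X) setT (act g) (@open X)) => //.
move=> _ [B oB <-]; rewrite setTI; apply: sub_sigma_algebra; exact: act_open.
Qed.

Let act_lsc (nu : probability (borel X) R) (A : set X) (c : \bar R) :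
  open A -> open [set g : G | (c < nu (act g @^-1` A))%E].
Proof.
move=> oA; rewrite openE => g0 /= cg0.
have [d [d0 ds dt nbd]] := metG.
pose V k := [set g : G | d g0 g < k.+1%:R^-1].
pose B k : set X := [set x : X | forall g, V k g -> A (act g x)]°.
have oB k : open (B k) by exact: open_interior.
have ndB : nondecreasing_seq (B : (set X)^nat).
  move=> m n mn; apply/subsetPset; apply: interiorS => x Bx g Vg; apply: Bx.
  apply: lt_le_trans Vg _.
  by rewrite lef_pV2 ?posrE ?ltr0n// ler_nat.
have UB : \bigcup_n B n = act g0 @^-1` A.
  apply/seteqP; split => x.
    move=> [n _ /interior_subset]; apply.
    by rewrite /V /= (d0 g0 g0).2// invr_gt0 ltr0n.
  move=> Ax.
  have /= : nbhs ((g0, x) : G * X) ((fun p : G * X => act p.1 p.2) @^-1` A).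
    by apply: (@act_cts (g0, x)); exact: open_nbhs_nbhs.
  move=> [[P Q] /= [/nbd[e e0 Pe] Qx] PQ].
  have [k ke] : exists k, k.+1%:R^-1 < e.
    exists (Num.truncn e^-1).
    rewrite -[ltRHS]invrK ltf_pV2 ?posrE ?invr_gt0 ?ltr0n//.
    exact: truncnS_gt.
  exists k => //; rewrite /B /interior; apply: filterS Qx => y Qy g Vg.
  apply: (PQ (g, y)); split => //; apply: Pe.
  exact: lt_trans Vg ke.
have mo (U : set X) : open U -> measurable (U : set (borel X)).
  exact: sub_sigma_algebra.
have cvB : nu \o B @ \oo --> nu (act g0 @^-1` A).
  rewrite -UB; apply: nondecreasing_cvg_mu => //.
  - by move=> k; exact: mo.
  - by apply: mo; exact: bigcup_open.
have [k ck] : exists k, (c < nu (B k))%E.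
  apply: contrapT => /forallNP nB.
  have : (nu (act g0 @^-1` A) <= c)%E.
    rewrite -(cvg_lim _ cvB)//; apply: lime_le.
      by apply/cvg_ex; eexists; exact: cvB.
    by apply: nearW => k; rewrite leNgt; apply/negP; exact: nB.
  by rewrite leNgt cg0.
apply/nbd; exists k.+1%:R^-1; first by rewrite invr_gt0 ltr0n.
move=> g Vg; apply: lt_le_trans ck _; apply: le_measure; rewrite ?inE.
- exact: mo.
- by apply: mo; exact: act_open.
- by move=> x /interior_subset; exact.
Qed.

Lemma measurable_fun_act (nu : probability (borel X) R) (A : set (borel X)) :
  measurable A -> measurable_fun [set: borel G] (fun g => nu (act g @^-1` A)).
Proof.
move=> mA; move: A mA.
apply: (@dynkin_induction _ (borel X) (@open X)
  (fun A => measurable_fun [set: borel G] (fun g => nu (act g @^-1` A)))) => //.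
- by move=> A B; exact: openI.
- by under eq_fun do rewrite preimage_setT; exact: measurable_cst.
- move=> A oA; apply: (measurability _ (ErealGenOInfty.measurableE R)).
  move=> /= _ [_ [a ->]] <-; rewrite setTI; apply: sub_sigma_algebra.
  by rewrite preimage_itvoy; exact: act_lsc.
- move=> A mA ih.
  rewrite (_ : (fun g => _) = (fun g => 1 - nu (act g @^-1` A))%E).
    by apply: emeasurable_funB => //; exact: measurable_cst.
  apply/funext => g; rewrite preimage_setC.
  exact: (probability_measure.probability_setC nu (act_measurable g mA)).
- move=> F mF tF ih.
  rewrite (_ : (fun g => _) =
      (fun g => \sum_(0 <= k <oo) nu (act g @^-1` F k))%E).
    by apply: ge0_emeasurable_sum => k //.
  apply/funext => g; rewrite preimage_bigcup measure_bigcup//.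
  + by apply: eq_eseriesl => k; exact: mem_set.
  + by move=> k _; exact: act_measurable.
  + by move=> i j _ _ [x [Fi Fj]]; apply: (tF i j) => //; exists (act g x).
Qed.

Section law.
Context (mu : probability (borel G) R) (nu : probability (borel X) R).

Definition convolution_fun (A : set (borel X)) : \bar R :=
  (\int[mu]_g nu (act g @^-1` A))%E.

Local Notation cv := convolution_fun.

Let cv0 : cv set0 = 0%E.
Proof.
by rewrite /convolution_fun integral0_eq// => g _; rewrite preimage_set0 measure0.
Qed.

Let cv_ge0 A : (0 <= cv A)%E.
Proof. by apply: integral_ge0 => g _; exact: measure_ge0. Qed.

Let cv_sigma_additive : semi_sigma_additive cv.
Proof.
move=> F mF tF mUF.
rewrite [X in _ --> X](_ : _ = (\sum_(n <oo) cv (F n))%E).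
  apply/cvg_closeP; split; last by rewrite closeE.
  by apply: is_cvg_nneseries => n _ _; exact: integral_ge0.
rewrite -integral_nneseries//; last first.
  by move=> n; exact: measurable_fun_act.
apply: eq_integral => g _.
rewrite preimage_bigcup measure_bigcup//.
- by apply: eq_eseriesl => k; exact: mem_set.
- by move=> k _; exact: act_measurable.
- by move=> i j _ _ [x [Fi Fj]]; apply: (tF i j) => //; exists (act g x).
Qed.

HB.instance Definition _ := isMeasure.Build _ _ _ cv cv0 cv_ge0 cv_sigma_additive.

Let cv_setT : cv setT = 1%E.
Proof.
rewrite /convolution_fun.
under eq_integral do rewrite preimage_setT probability_setT.
by rewrite integral_cst// mul1e; exact: probability_setT.
Qed.

HB.instance Definition _ := Measure_isProbability.Build _ _ _ cv cv_setT.

(* [mu * nu], the law of [act g x] for independent [g] and [x] of laws [mu]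
   and [nu]. *)
Definition convolution : probability (borel X) R := cv.

Lemma convolutionE (A : set (borel X)) :
  convolution A = (\int[mu]_g nu (act g @^-1` A))%E.
Proof. by []. Qed.
End law.
End convolution.

Definition convolution_power (R : realType) (G : topologicalGroupType)
    (metG : metrizable R G) (mu : probability (borel G) R) (n : nat) :
    probability (borel G) R :=
  iter n
    (fun nu : probability (borel G) R =>
       convolution metG (@mulg_continuous G) mu nu)
    (dirac (1%g : borel G)).

Definition spread_out (R : realType) (G : topologicalGroupType)
    (metG : metrizable R G) (mu : probability (borel G) R) :=
  exists (m : {measure set (borel G) -> \bar R}) (n : nat),
    [/\ haar m, (0 < n)%N &
        ~ mutually_singular (convolution_power metG mu n) m].

Definition msupport (R : realType) (T : ptopologicalType)
    (m : {measure set (borel T) -> \bar R}) : set T :=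
  [set x | forall U : set T, open_nbhs x U -> (0 < m U)%E].

Section subgroups.
Context (G : topologicalGroupType).
Implicit Types H K A : set G.

Definition subgroup H := group_closed (mem H).

Definition closed_subgroup_generated A : set G :=
  smallest [set H | subgroup H /\ closed H] A.

Definition commutator_subgroup H : set G :=
  smallest subgroup [set [~ x, y]%g | x in H & y in H].

Definition normal_in H K :=
  [/\ subgroup H, H `<=` K & forall h k, H h -> K k -> H (h ^ k)%g].

Definition open_in H K := exists2 U : set G, open U & H = K `&` U.

Definition left_coset (g : G) H : set G := [set (g * h)%g | h in H].

End subgroups.

Section adapted_aperiodic.
Context (R : realType) (G : topologicalGroupType) (mu : probability (borel G) R).

Definition generated_by_support : set G :=
  closed_subgroup_generated (msupport mu).

Definition adapted := generated_by_support = setT.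

(* An open subgroup [H] of the closed group generated by the support is closed,
   so that the cosets of [H] are Borel sets. *)
Definition aperiodic :=
  ~ exists (H : set G) (g : G),
      [/\ normal_in H generated_by_support, open_in H generated_by_support,
          H <> generated_by_support,
          commutator_subgroup generated_by_support `<=` H &
          generated_by_support g /\ mu (left_coset g H) = 1%E].

End adapted_aperiodic.

Section coset_space.
Context (G : topologicalGroupType) (Gamma : groupClosed G).

(* Left cosets [g Gamma]. *)
Definition coset_rel : rel G := fun x y => (x^-1 * y)%g \in Gamma.

Let coset_refl : reflexive coset_rel.
Proof. by move=> x; rewrite /coset_rel mulVg gpred1. Qed.

Let coset_sym : symmetric coset_rel.
Proof. by move=> x y; rewrite /coset_rel -gpredV invgM invgK. Qed.

Let coset_trans : transitive coset_rel.
Proof.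
move=> y x z; rewrite /coset_rel => xy yz.
by have := gpredM _ _ xy yz; rewrite mulgA mulgK.
Qed.

Canonical coset_equiv := EquivRel coset_rel coset_refl coset_sym coset_trans.

Definition coset_space : ptopologicalType :=
  quotient_topology {eq_quot coset_rel}.

Definition coset_pi (g : G) : coset_space :=
  \pi_(quotient_topology {eq_quot coset_rel}) g.

Definition coset_act (g : G) (x : coset_space) : coset_space :=
  coset_pi (g * repr (x : quotient_topology {eq_quot coset_rel}))%g.

Lemma coset_piP (g h : G) : coset_pi g = coset_pi h <-> (g^-1 * h)%g \in Gamma.
Proof. by split=> /(@eqmodP _ coset_equiv). Qed.

Lemma coset_act_pi (g h : G) : coset_act g (coset_pi h) = coset_pi (g * h)%g.
Proof.
apply/coset_piP; rewrite invgM mulgA mulgVK.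
by apply/coset_piP; rewrite /coset_pi reprK.
Qed.

Lemma coset_pi_continuous : continuous coset_pi.
Proof. exact: pi_continuous. Qed.

Lemma coset_pi_open (U : set G) : open U -> open (coset_pi @` U).
Proof.
move=> oU; rewrite /open /= /quotient_open.
rewrite (_ : _ @^-1` _ =
    \bigcup_(c in [set` Gamma]) (fun g : G => (g * c)%g) @^-1` U).
  apply: bigcup_open => c _; move: U oU; apply/continuousP => g.
  apply: (@continuous_comp _ _ _ (fun g : G => (g, c))
    (fun p : G * G => (p.1 * p.2)%g)); last exact: mulg_continuous.
  by apply: cvg_pair; [exact: cvg_id|exact: cvg_cst].
apply/seteqP; split=> g /=.
  move=> [u Uu /esym/coset_piP ugG]; exists (g^-1 * u)%g => //=.
  by rewrite mulVKg.
move=> [c cG Ugc]; exists (g * c)%g => //; apply/coset_piP.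
by rewrite invgM mulgVK gpredV.
Qed.

Lemma coset_act_continuous :
  continuous (fun p : G * coset_space => coset_act p.1 p.2).
Proof.
move=> [g x] A /=.
have [h hx] : exists h, coset_pi h = x.
  by exists (repr (x : quotient_topology {eq_quot coset_rel})); exact: reprK.
rewrite -{}hx coset_act_pi => nA.
have /= [[P Q] /= [Pg Qh] PQ] : nbhs ((g, h) : G * G)
    ((fun p : G * G => coset_pi (p.1 * p.2)%g) @^-1` A).
  apply: (@continuous_comp _ _ _ (fun p : G * G => (p.1 * p.2)%g) coset_pi) => //.
    exact: mulg_continuous.
  exact: coset_pi_continuous.
have nQ : nbhs (coset_pi h) (coset_pi @` Q°).
  apply: open_nbhs_nbhs; split.
    by apply: coset_pi_open; exact: open_interior.
  by exists h => //; exact: nbhs_singleton (nbhs_interior Qh).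
exists (P, coset_pi @` Q°) => //.
move=> [g' _] /= [Pg' [q /interior_subset Qq <-]].
by rewrite /= coset_act_pi; exact: (PQ (g', q)).
Qed.

End coset_space.

Definition discrete_set (T : topologicalType) (A : set T) :=
  A `<=` isolated A.

Definition is_lattice (R : realType) (G : topologicalGroupType)
    (Gamma : groupClosed G) :=
  discrete_set [set` Gamma] /\
  exists m : {finite_measure set (borel (coset_space Gamma)) -> \bar R},
    [/\ radon m, m setT <> 0%E & invariant (@coset_act G Gamma) m].

Definition normalized_haar (R : realType) (G : topologicalGroupType)
    (Gamma : groupClosed G) (m : probability (borel (coset_space Gamma)) R) :=
  radon m /\ invariant (@coset_act G Gamma) m.

Section total_variation.
Context d (X : measurableType d) (R : realType).

Definition complex_measurable (f : X -> R[i]) :=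
  measurable_fun setT (fun x => complex.Re (f x)) /\
  measurable_fun setT (fun x => complex.Im (f x)).

Section integral.
Variable nu : {charge set X -> \bar R}.

(* By uniqueness of the Jordan decomposition, [charge_pos] and [charge_neg] do
   not depend on the choice of a Hahn decomposition. *)
Let hahn := svalP (cid (svalP (cid (Hahn_decomposition nu)))).

Definition charge_pos : {finite_measure set X -> \bar R} := jordan_pos hahn.
Definition charge_neg : {finite_measure set X -> \bar R} := jordan_neg hahn.

Definition charge_integral (f : X -> R) : R :=
  \int[charge_pos]_x f x - \int[charge_neg]_x f x.

Definition charge_cintegral (f : X -> R[i]) : R[i] :=
  Complex (charge_integral (fun x => complex.Re (f x)))
          (charge_integral (fun x => complex.Im (f x))).

(* The modulus of [z : R[i]] is the element [`|z|] of [R[i]], which is real. *)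
Definition tv_norm : \bar R :=
  ereal_sup [set (complex.Re `|charge_cintegral f|)%:E |
    f in [set f | complex_measurable f /\ forall x, `|f x| <= 1]].
End integral.

Definition charge_diff (P Q : probability X R) : {charge set X -> \bar R} :=
  cadd (charge_of_finite_measure P) (copp (charge_of_finite_measure Q)).

End total_variation.

(* Main.v *)
Require Import Defs.
From HB Require Import structures.
From mathcomp Require Import all_boot all_order all_algebra complex.
From mathcomp Require Import all_classical all_reals all_analysis.
From mathcomp Require Import measurable_realfun ring lra.

Set Implicit Arguments.
Unset Strict Implicit.
Unset Printing Implicit Defensive.

Import Order.TTheory GRing.Theory Num.Theory.
Import numFieldNormedType.Exports.

Local Open Scope classical_set_scope.
Local Open Scope ring_scope.

(** The walk forgets its starting point because two trajectories started at
    different points have asymptotically the same law.  Write [mu^n x] for the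
    law of the walk at time [n] started at [x], and [D (x, y)] for the limit of
    the distance between [mu^n x] and [mu^n y].  It suffices to show [D = 0]:
    averaging over [y] with respect to the invariant law gives the convergence.

    Spreading out enters through equicontinuity.  Some power of [mu] dominates
    a nonzero multiple [a] of a right Haar measure restricted to a compact set,
    and the integrals against [a] of functions with values in [0, 1] vary little
    under small right translations, uniformly in the function.  Peeling off one
    copy of [a] at a time multiplies what remains by a factor less than 1, so
    that [mu^n g] and [mu^n] are uniformly close for [n] large and [g] near 1
    ([spread_out_equicontinuous]).  Hence [D] is a continuous pseudometric with
    [D (g x, x)] small for [g] near 1.

    Running the two trajectories independently gives
    [D (x, y) <= E (D (g x, h y))] for independent [g], [h] of law [mu^n]:
    [D] is subharmonic for a walk on [X * X] preserving a probability measure of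
    full support.  Comparing second moments, a bounded subharmonic function is
    then invariant along almost every step ([subharmonic_invariant]), and by
    continuity [D (g x, h y) = D (x, y)] for all [x], [y] and all [g], [h] in
    the support of [mu^n] ([gap_invariant]).

    Let [H] be the group of the [g] with [D (z, g z) = 0] for all [z].  Taking
    [x = y] above shows that [H] contains [g^-1 h] for [g], [h] in the support
    of [mu^n], and equicontinuity makes [H] a neighbourhood of 1.  If [X] is
    connected, the open orbits of [H] have to be all of [X].  If [mu] is
    adapted, all of [G] preserves [D], so that [H] is normal; all points of the
    support of [mu] are congruent modulo [H], so that they commute modulo [H],
    and so does [G].  Thus [mu] is carried by a coset of an open normal subgroup
    with abelian quotient, and aperiodicity forces [H = G].  In both cases
    [D = 0].

    The supremum over all Borel sets that defines the distance of two laws need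
    not be visibly measurable in [(x, y)].  It is replaced by a supremum over
    the sets of one sequence [A], chosen at the end so that [A n] nearly
    realizes the distance between [mu^n x0] and the invariant law; [gap] below
    is [D] computed with this sequence. *)

(** * Second countable spaces and their Borel sets *)

Lemma second_countableP (T : topologicalType) : @second_countable T ->
  exists U : (set T)^nat, (forall i, open (U i)) /\
    forall x A, nbhs x A -> exists2 i, U i x & U i `<=` A.
Proof.
move=> [B cB [oB fB]].
have [B0|[f]] := pfcard_geP cB.
  exists (fun=> set0); split=> [i|x A nA]; first exact: open0.
  by have [W /= [+ _] _] := fB x A nA; rewrite B0.
exists f; split=> [i|x A nA]; first by apply: oB; exact: funS.
have [W /= [BW Wx] WA] := fB x A nA.
by have [i _ fi] := @surj _ _ _ _ f W BW; exists i; rewrite fi.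
Qed.

Lemma open_map_second_countable (S T : topologicalType) (f : S -> T) :
  continuous f -> (forall U, open U -> open (f @` U)) ->
  (forall y, exists x, f x = y) ->
  @second_countable S -> @second_countable T.
Proof.
move=> cf of_ sf /second_countableP[U [oU bU]].
exists (range (fun i => f @` U i));
  first exact: sub_countable (card_image_le _ _) _.
split=> [_ [i _ <-]|y A]; first exact: of_.
have [x <-] := sf y => /cf nA.
have [i Uix UiA] := bU x _ nA.
exists (f @` U i); first by split; [exists i|exists x].
by move=> _ [z /UiA Az <-].
Qed.

Lemma metrizable_dist_open (R : realType) (T : topologicalType)
    (d : T -> T -> R) :
  (forall x y z, d x z <= d x y + d y z) ->
  (forall x (A : set T), nbhs x A <->
          exists2 e : R, 0 < e & [set y | d x y < e] `<=` A) ->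
  forall x e, open [set y | d x y < e].
Proof.
move=> dt nbd x e; rewrite openE => y /= dy; apply/nbd.
exists (e - d x y); first by rewrite subr_gt0.
by move=> z /= dz; apply: le_lt_trans (dt x y z) _; rewrite -ltrBrDl.
Qed.

Lemma metrizable_hausdorff (R : realType) (T : topologicalType) :
  metrizable R T -> hausdorff_space T.
Proof.
move=> [d [d0 ds dt nbd]] x y xy; apply/d0/eqP.
have dge0 : 0 <= d x y.
  have := dt x y x; rewrite (d0 x x).2// (ds y x) -mulr2n pmulrn_lge0//.
rewrite eq_le dge0 andbT leNgt; apply/negP => dxy0.
have nb z : nbhs z [set w | d z w < d x y / 2].
  by apply/nbd; exists (d x y / 2) => //; rewrite divr_gt0.
have [z /= [xz yz]] := xy _ _ (nb x) (nb y).
rewrite ds in yz.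
by have := le_lt_trans (dt x z y) (ltrD xz yz); rewrite -splitr ltxx.
Qed.

(** For each radius [1 / (n + 1)], each compact piece is covered by finitely
    many balls; these countably many balls form a base. *)
Lemma sigma_compact_second_countable (R : realType) (T : ptopologicalType) :
  metrizable R T -> sigma_compact T -> @second_countable T.
Proof.
move=> [d [d0 ds dt nbd]] [K [cK UK]].
have obl := metrizable_dist_open dt nbd.
pose bl (n : nat) x := [set y | d x y < n.+1%:R^-1].
have bl_self n x : bl n x x by rewrite /bl /= (d0 x x).2// invr_gt0 ltr0n.
have fin (m n : nat) : exists D : set T,
  countable D /\ K m `<=` \bigcup_(x in D) bl n x.
  have := cK m; rewrite compact_cover => /(_ T setT (bl n)) [| |D _ KD].
  - by move=> x _; exact: obl.
  - by move=> x _; exists x.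
  - by eexists; split; last exact: KD; exact: countable_fset.
pose D m := projT1 (choice (fin m)); pose DP m := projT2 (choice (fin m)).
exists (\bigcup_m \bigcup_n (bl n @` D m n)).
  apply: bigcup_countable => // m _; apply: bigcup_countable => // n _.
  by apply: sub_countable (card_image_le _ _) _; by have [] := DP m n.
split=> [_ [m _ [n _ [x _ <-]]]|x A /nbd[e e0 eA]]; first exact: obl.
have [m _ Kmx] : (\bigcup_n K n) x by rewrite UK.
have [n ne] : exists n : nat, n.+1%:R^-1 < e / 2.
  exists (Num.truncn (e / 2)^-1).
  rewrite -[ltRHS]invrK ltf_pV2 ?posrE ?invr_gt0 ?ltr0n ?divr_gt0//.
  exact: truncnS_gt.
have [z Dz zx] := (DP m n).2 x Kmx.
exists (bl n z).
  by split=> //; exists m => //; exists n => //; exists z.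
move=> y /= zy; apply: eA => /=.
rewrite [ltRHS]splitr (le_lt_trans (dt x z y))// ltrD//.
- by rewrite ds (lt_trans zx).
- exact: lt_trans zy ne.
Qed.

Lemma open_borel (T : ptopologicalType) (U : set T) :
  open U -> measurable (U : set (borel T)).
Proof. exact: sub_sigma_algebra. Qed.

Lemma closed_borel (T : ptopologicalType) (F : set T) :
  closed F -> measurable (F : set (borel T)).
Proof.
by move=> /closed_openC/open_borel/measurableC; rewrite setCK.
Qed.

Lemma continuous_borel (S T : ptopologicalType) (f : S -> T) :
  continuous f -> measurable_fun setT (f : borel S -> borel T).
Proof.
move=> cf; apply: (@measurability _ _ (borel S) (borel T) setT f (@open T)) =>
  //.
move=> _ [B oB <-]; rewrite setTI; apply: open_borel.
by move/continuousP : cf; exact.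
Qed.

(** An open subset of the product is a countable union of products of basic
    open sets; this is where a countable base matters, since the product of the
    Borel sigma-algebras may be too small in general. *)
Lemma open_prod_borel (S T : ptopologicalType) (O : set (S * T)) :
  @second_countable S -> @second_countable T -> open O ->
  measurable (O : set (borel S * borel T)).
Proof.
move=> /second_countableP[U [oU bU]] /second_countableP[V [oV bV]] oO.
have -> : O = \bigcup_i \bigcup_(j in [set j | U i `*` V j `<=` O])
  (U i `*` V j).
  apply/seteqP; split=> [[x y] Oxy|[x y] [i _ [j /= UVO UVxy]]];
    last exact: UVO.
  have /= [[P Q] /= [Px Qy] PQ] : nbhs
    ((x, y) : S * T) O by exact: open_nbhs_nbhs.
  have [i Uix UiP] := bU x P Px; have [j Vjy VjQ] := bV y Q Qy.
  exists i => //; exists j => //=.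
  by move=> [x' y'] [/= /UiP Px' /VjQ Qy']; exact: PQ.
apply: bigcupT_measurable => i; apply: bigcup_measurable => j _.
by apply: measurableX; exact: open_borel.
Qed.

Lemma continuous_prod_borel (S T Z : ptopologicalType) (f : S * T -> Z) :
  @second_countable S -> @second_countable T -> continuous f ->
  measurable_fun setT (f : borel S * borel T -> borel Z).
Proof.
move=> cS cT cf.
apply: (@measurability _ _ (borel S * borel T)%type (borel Z) setT f
  (@open Z)) => //.
move=> _ [B oB <-]; rewrite setTI; apply: open_prod_borel => //.
by move/continuousP : cf; exact.
Qed.

(** The basic open sets of measure zero are countably many and cover [A]. *)
Lemma locally_null (R : realType) (T : ptopologicalType)
    (m : {measure set (borel T) -> \bar R}) (A : set (borel T)) :
  @second_countable T -> measurable A ->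
  (forall x, A x -> exists U : set T, open_nbhs x U /\ m U = 0%E) -> m A = 0%E.
Proof.
move=> /second_countableP[U [oU bU]] mA Anull.
pose N := \bigcup_(i in [set i | m (U i) = 0%E]) (U i : set (borel T)).
have AN : A `<=` N.
  move=> x /Anull[V [oVx mV0]].
  have [i Uix UiV] := bU x V (open_nbhs_nbhs oVx).
  exists i => //=; apply: subset_measure0 mV0 => //; first exact: open_borel.
  by apply: open_borel; case: oVx.
have mN : measurable N by apply: bigcup_measurable => i _; exact: open_borel.
apply: (subset_measure0 _ _ AN) => //; apply/negligibleP => //.
rewrite /N bigcup_mkcond; apply: negligible_bigcup => i; case: ifPn.
  by rewrite inE => /= Ui0; apply/negligibleP => //; exact: open_borel.
by move=> _; exact: negligible_set0.
Qed.

Lemma nbhs_prod_open (S T : topologicalType) (x : S) (y : T) (W : set (S * T)) :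
  nbhs (x, y) W -> exists (U : set S) (V : set T),
    [/\ open_nbhs x U, open_nbhs y V & forall x' y', U x' -> V y' ->
      W (x', y')].
Proof.
move=> [[P Q] /= [Px Qy] PQ]; exists P°, Q°; split.
- by split; [exact: open_interior|exact: nbhs_singleton (nbhs_interior Px)].
- by split; [exact: open_interior|exact: nbhs_singleton (nbhs_interior Qy)].
- by move=> x' y' /interior_subset Px' /interior_subset Qy';
  exact: (PQ (x', y')).
Qed.

(** * Integration *)

Lemma measurable_section d1 d2 (S : measurableType d1) (T : measurableType d2)
    (R : realType) (m : {sigma_finite_measure set T -> \bar R})
      (C : set (S * T)) :
  measurable C -> measurable_fun setT (fun x => m [set y | C (x, y)]).
Proof.
move=> mC; rewrite (_ : (fun x => _) = m \o xsection C).
  exact: measurable_fun_xsection.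
by apply/funext => x /=; congr (m _); apply/seteqP; split=> y /=;
  rewrite /xsection/= inE.
Qed.

Lemma measurable_preimage d1 d2 (S : measurableType d1) (T : measurableType d2)
    (f : S -> T) (A : set T) :
  measurable_fun setT f -> measurable A -> measurable (f @^-1` A).
Proof. by move=> mf mA; rewrite -[_ @^-1` _]setTI; exact: mf. Qed.

Lemma fubini_section d1 d2 (S : measurableType d1) (T : measurableType d2)
    (R : realType) (m1 : {sigma_finite_measure set S -> \bar R})
    (m2 : {sigma_finite_measure set T -> \bar R}) (C : set (S * T)) :
  measurable C ->
  (\int[m1]_x m2 [set y | C (x, y)] = \int[m2]_y m1 [set x | C (x, y)])%E.
Proof.
move=> mC; have := indic_fubini_tonelli m1 m2 mC.
rewrite indic_fubini_tonelli_FE// indic_fubini_tonelli_GE// => H.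
transitivity (\int[m1]_x (m2 \o xsection C) x)%E.
  apply: eq_integral => x _ /=; congr (m2 _).
  by apply/seteqP; split=> y /=; rewrite /xsection/= inE.
rewrite H; apply: eq_integral => y _ /=; congr (m1 _).
by apply/seteqP; split=> x /=; rewrite /ysection/= inE.
Qed.

(** The library carries sigma-finiteness in the type of a measure; this alias
    attaches a proof of it to a given measure. *)
Section sigma_finite_alias.
Context d (T : measurableType d) (R : realType).
Context (m : {measure set T -> \bar R}) (sfm : sigma_finite setT m).

Definition with_sigma_finite of sigma_finite setT m : set T -> \bar R := m.
Local Notation n := (with_sigma_finite sfm).

HB.instance Definition _ := isMeasure.Build d T R n
  (measure0 m) (measure_ge0 m) (@measure_semi_sigma_additive _ _ _ m).
HB.instance Definition _ := Measure_isSigmaFinite.Build d T R n sfm.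

End sigma_finite_alias.

Lemma null_bigcup d (T : measurableType d) (R : realType)
    (m : {measure set T -> \bar R}) (F : (set T)^nat) :
  (forall i, measurable (F i)) -> (forall i, m (F i) = 0%E) ->
  m (\bigcup_i F i) = 0%E.
Proof.
move=> mF F0; apply/negligibleP; first exact: bigcup_measurable.
by apply: negligible_bigcup => i; apply/negligibleP => //; exact: F0.
Qed.

Lemma integral_cst_probability d (T : measurableType d) (R : realType)
    (P : probability T R) (c : \bar R) : (\int[P]_x c = c)%E.
Proof.
rewrite integral_cst//; transitivity (c * 1)%E; last by rewrite mule1.
by congr (_ * _)%E; exact: probability_setT.
Qed.

Lemma dist_integral_le d (T : measurableType d) (R : realType)
    (P : probability T R) (f h t : T -> R) (a b : R) :
  measurable_fun setT f -> measurable_fun setT h -> measurable_fun setT t ->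
  (forall x, 0 <= f x) -> (forall x, 0 <= h x) ->
    (forall x, `|f x - h x| <= t x) ->
  (\int[P]_x (f x)%:E = a%:E)%E -> (\int[P]_x (h x)%:E = b%:E)%E ->
  (`|a - b|%:E <= \int[P]_x (t x)%:E)%E.
Proof.
move=> mf mh mt f0 h0 fht fa hb.
have t0 x : 0 <= t x by exact: le_trans (fht x).
have le1 (f' h' : T -> R) (a' b' : R) :
    measurable_fun setT f' -> measurable_fun setT h' ->
    (forall x, 0 <= f' x) -> (forall x, 0 <= h' x) ->
      (forall x, f' x <= h' x + t x) ->
    (\int[P]_x (f' x)%:E = a'%:E)%E -> (\int[P]_x (h' x)%:E = b'%:E)%E ->
    (a'%:E <= b'%:E + \int[P]_x (t x)%:E)%E.
  move=> mf' mh' f'0 h'0 le <- <-; rewrite -ge0_integralD//; last 4 first.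
  - by move=> x _; rewrite lee_fin.
  - exact/measurable_EFinP.
  - by move=> x _; rewrite lee_fin.
  - exact/measurable_EFinP.
  apply: ge0_le_integral => //.
  - by move=> x _; rewrite lee_fin.
  - exact/measurable_EFinP.
  - by apply: emeasurable_funD; exact/measurable_EFinP.
  - by move=> x _; rewrite -EFinD lee_fin.
have le_ab : (a%:E <= b%:E + \int[P]_x (t x)%:E)%E.
  apply: (le1 f h) => // x; have := fht x; rewrite ler_norml => /andP[_]; lra.
have le_ba : (b%:E <= a%:E + \int[P]_x (t x)%:E)%E.
  apply: (le1 h f) => // x; have := fht x; rewrite ler_norml => /andP[+ _]; lra.
move: le_ab le_ba; have :=
  @integral_ge0 _ _ _ P setT (fun x => (t x)%:E) (fun x _ => t0 x).
case: (\int[P]_x (t x)%:E)%E => [I _|_ _ _|//]; last by rewrite leey.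
by rewrite -!EFinD !lee_fin ler_norml => *; lra.
Qed.

Lemma bounded_cvg_integral d (T : measurableType d) (R : realType)
    (P : probability T R) (f_ : (T -> R)^nat) (f : T -> R) :
  (forall n, measurable_fun setT (f_ n)) -> (forall n x, 0 <= f_ n x <= 1) ->
  (forall x, f_ ^~ x @ \oo --> f x) ->
  (\int[P]_x (f_ n x)%:E)%E @[n --> \oo] --> (\int[P]_x (f x)%:E)%E.
Proof.
move=> mf f01 cvf.
apply: (@dominated_cvg _ _ _ P setT measurableT (fun n x => (f_ n x)%:E)
  (fun x => (f x)%:E) (fun=> 1%E)) => //.
- by move=> n; exact/measurable_EFinP.
- by move=> x _; apply: cvg_EFin; [exact: nearW|exact: cvf].
- exact: finite_measure_integrable_cst.
- by move=> n x _; have /andP[f0 f1] := f01 n x; rewrite /= lee_fin ger0_norm.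
Qed.

(** * Topological groups and convolution powers *)

Lemma continuous_mulg (T : topologicalType) (G : topologicalGroupType)
    (f g : T -> G) :
  continuous f -> continuous g -> continuous (fun x => (f x * g x)%g).
Proof.
move=> cf cg x; apply: (@continuous_comp _ _ _ (fun x => (f x, g x))
  (fun p : G * G => (p.1 * p.2)%g)); last exact: mulg_continuous.
by apply: cvg_pair; [exact: cf|exact: cg].
Qed.

Lemma subgroup_intro (G : topologicalGroupType) (H : set G) :
  H 1%g -> (forall x y, H x -> H y -> H (x * y)%g) ->
    (forall x, H x -> H (x^-1)%g) ->
  subgroup H.
Proof.
move=> H1 HM HV; split; first exact: mem_set.
by move=> x y /set_mem Hx /set_mem Hy; apply: mem_set; apply: HM => //;
  exact: HV.
Qed.

Lemma open_subgroup (G : topologicalGroupType) (H : set G) : subgroup H ->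
    nbhs (1%g : G) H -> open H.
Proof.
move=> [_ Hd] nH; apply/interior_id/seteqP; split; first exact: interior_subset.
move=> g Hg.
have cm : continuous (fun x : G => (x * g^-1)%g).
  by apply: (@continuous_mulg _ _ id (fun=> g^-1)%g) => y;
    [exact: cvg_id|exact: cvg_cst].
have : nbhs g ((fun x : G => (x * g^-1)%g) @^-1` H) by apply: cm; rewrite mulgV.
apply: filterS => x Hx.
have HV y : H y -> H (y^-1)%g.
  move=> Hy; have H1 : H 1%g by exact: nbhs_singleton nH.
  by have := Hd 1%g y (mem_set H1) (mem_set Hy); rewrite mul1g => /set_mem.
rewrite -[x](mulgVK g) -[X in (_ * X)%g]invgK.
exact/set_mem/Hd/mem_set/HV/Hg/mem_set.
Qed.

Section measurable_group.
Context (G : topologicalGroupType) (scG : @second_countable G).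

Lemma measurable_mulg d (T : measurableType d) (f g : T -> borel G) :
  measurable_fun setT f -> measurable_fun setT g ->
  measurable_fun setT (fun x => (f x * g x : G)%g : borel G).
Proof.
move=> mf mg.
have mM : measurable_fun setT
    ((fun p : G * G => (p.1 * p.2)%g) : borel G * borel G -> borel G).
  by apply: continuous_prod_borel => //; exact: mulg_continuous.
exact: (measurableT_comp mM (measurable_fun_pair mf mg)).
Qed.

Lemma measurable_mulgr (g : G) :
  measurable_fun setT ((fun h : G => (h * g)%g) : borel G -> borel G).
Proof. by apply: measurable_mulg => //; exact: measurable_id. Qed.

Lemma measurable_mulgl (g : G) :
  measurable_fun setT ((fun h : G => (g * h)%g) : borel G -> borel G).
Proof. by apply: measurable_mulg => //; exact: measurable_id. Qed.

Lemma measurable_invg :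
  measurable_fun setT ((fun h : G => (h^-1)%g) : borel G -> borel G).
Proof. by apply: continuous_borel; exact: invg_continuous. Qed.

Lemma measurable_preimage_mulgr (g : G) (B : set (borel G)) : measurable B ->
  measurable ((fun h : G => (h * g)%g) @^-1` B : set (borel G)).
Proof. exact: (measurable_preimage (measurable_mulgr g)). Qed.

Lemma measurable_preimage_mulgl (g : G) (B : set (borel G)) : measurable B ->
  measurable ((fun h : G => (g * h)%g) @^-1` B : set (borel G)).
Proof. exact: (measurable_preimage (measurable_mulgl g)). Qed.

End measurable_group.

Section convolution_powers.
Context (R : realType) (G : topologicalGroupType) (scG : @second_countable G).
Context (metG : metrizable R G) (mu : probability (borel G) R).

Local Notation p := (convolution_power metG mu).

Lemma convolution_powerS n (B : set (borel G)) :
  p n.+1 B = (\int[mu]_g p n ((fun h : G => (g * h)%g) @^-1` B))%E.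
Proof. by []. Qed.

(** The definition of the powers splits off the last step of the walk, on the
    left; moving the starting point calls for splitting off the first [k]
    steps, on the right. Fubini's theorem reconciles the two. *)
Lemma convolution_powerD n k (B : set (borel G)) : measurable B ->
  p (n + k) B = (\int[p k]_g p n ((fun h : G => (h * g)%g) @^-1` B))%E.
Proof.
elim: n B => [|n ih] B mB.
  rewrite add0n -[B in LHS]setIT -integral_indic//.
  by apply: eq_integral => g _; rewrite /= diracE indicE;
    congr ((nat_of_bool _)%:R%:E); apply/idP/idP;
    rewrite !inE /preimage/= mul1g.
rewrite addSn convolution_powerS.
under eq_integral do (rewrite ih; last exact: measurable_preimage_mulgl).
under [RHS]eq_integral do rewrite convolution_powerS.
move: (p n) (p k) => q r {ih}.
pose C := [set w : (borel G * borel G) * borel G | B (w.1.1 * (w.2 * w.1.2))%g].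
have mC : measurable C.
  suff mf : measurable_fun setT (fun w : (borel G * borel G) * borel G =>
      (w.1.1 * (w.2 * w.1.2) : G)%g : borel G).
    exact: (measurable_preimage mf mB).
  apply: measurable_mulg => //.
    exact: (measurableT_comp measurable_fst measurable_fst).
  apply: measurable_mulg => //.
  exact: (measurableT_comp measurable_snd measurable_fst).
have := fubini_tonelli (m1 := mu) (m2 := r)
  (fun z => q [set h | C (z, h)]) (measurable_section q mC) (fun=>
    measure_ge0 _ _).
move=> /= ->; apply: eq_integral => g _; apply: eq_integral => h _.
by congr (q _); apply/seteqP; split=> x; rewrite /C/= mulgA.
Qed.

End convolution_powers.

Section support.
Context (R : realType) (T : ptopologicalType) (m : probability (borel T) R).
Hypothesis scT : @second_countable T.

Lemma open_setC_msupport : open (~` msupport m).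
Proof.
apply/interior_id/seteqP; split; first exact: interior_subset.
move=> x /existsNP[U /not_implyP[[oU Ux] mU]].
apply: (filterS _ (open_nbhs_nbhs (conj oU Ux))) => y Uy.
by move=> /(_ U (conj oU Uy)).
Qed.

Lemma measurable_msupport : measurable (msupport m : set (borel T)).
Proof.
by rewrite -[msupport m]setCK; apply: measurableC; apply: open_borel;
  exact: open_setC_msupport.
Qed.

Lemma msupportC0 : m (~` msupport m) = 0%E.
Proof.
apply: locally_null => //; first by apply: measurableC;
  exact: measurable_msupport.
move=> x /existsNP[U /not_implyP[oU /negP mU]]; exists U; split => //.
by apply/eqP; move: mU; rewrite lt0e measure_ge0 andbT negbK.
Qed.

Lemma msupport1 : m (msupport m) = 1%E.
Proof.
rewrite -[msupport m]setCK probability_setC; last first.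
  by apply: measurableC; exact: measurable_msupport.
by rewrite msupportC0 sube0.
Qed.

End support.

(** * Haar measures and the measures not singular to them *)

Section haar.
Context (R : realType) (G : topologicalGroupType).
Hypotheses (sigma_compactG : sigma_compact G) (metG : metrizable R G).
Context (m : {measure set (borel G) -> \bar R}) (hm : haar m).

Let scG : @second_countable G :=
  sigma_compact_second_countable metG sigma_compactG.

Lemma compact_borel (K : set G) : compact K -> measurable (K : set (borel G)).
Proof.
by move=> cK; apply: closed_borel; apply: compact_closed => //;
  exact: metrizable_hausdorff metG.
Qed.

Lemma haar_sigma_finite : sigma_finite setT m.
Proof.
have [K [cK UK]] := sigma_compactG; have [[fm _ _] _ _] := hm.
by exists K => // i; split; [exact: compact_borel|exact: fm].
Qed.

(** Fubini's theorem for the set of the pairs [(x, y)] with [y^-1 * x] in [A]: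
    its sections at fixed [y] are left translates of [A], hence null, whereas
    its sections at fixed [x] are left translates of the inverse of [A]. *)
Lemma haar_null_invg (A : set (borel G)) : measurable A -> m A = 0%E ->
  m ((fun h : G => (h^-1)%g) @^-1` A) = 0%E.
Proof.
move=> mA mA0; have [_ m0 inv] := hm.
pose n : {sigma_finite_measure set (borel G) -> \bar R} :=
  with_sigma_finite haar_sigma_finite.
pose C := [set z : borel G * borel G | A ((z.2^-1 : G) * z.1 : G)%g].
have mC : measurable C.
  suff mf : measurable_fun setT (fun z : borel G * borel G =>
      (((z.2 : G)^-1)%g * z.1 : G)%g : borel G).
    exact: (measurable_preimage mf mA).
  apply: measurable_mulg => //.
  exact: (measurableT_comp (measurable_invg (G := G)) measurable_snd).
have := fubini_section n n mC.
rewrite [RHS]integral0_eq; last first.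
  by move=> y _; rewrite -mA0 -[RHS](inv (y^-1 : G)%g).
have invA x : n [set y | C (x, y)] = m ((fun h : G => (h^-1)%g) @^-1` A).
  rewrite -(inv x [set y | C (x, y)]);
    last exact: (measurable_preimage (pair1_measurable x) mC).
  by congr (m _); apply/seteqP; split => y; rewrite /C/= invgM mulgVK.
under eq_integral do rewrite invA.
rewrite integral_cst//= => /eqP; rewrite mule_eq0 => /orP[/eqP //|/eqP].
by move=> /m0.
Qed.

End haar.

(** Take Hahn decompositions of [l - t k] for [t = 1 / (j + 1)]. If [k]
    vanished on all the positive sets, their union would be [k]-null, and
    outside it [l] would be at most [t k] for all [t]: then [l] and [k] would
    be singular. *)
Lemma not_singular_minorized d (T : measurableType d) (R : realType)
    (l k : {finite_measure set T -> \bar R}) : ~ mutually_singular l k ->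
  exists (t : R) (P : set T), [/\ 0 < t, measurable P, (0 < k P)%E &
    forall A, measurable A -> A `<=` P -> (t%:E * k A <= l A)%E].
Proof.
move=> nsing; apply: contrapT => nP; apply: nsing.
pose t (j : nat) : R := j.+1%:R^-1.
have t0 j : 0 < t j by rewrite invr_gt0 ltr0n.
pose nu j : {charge set T -> \bar R} := cadd (charge_of_finite_measure l)
  (cscale (- t j) (charge_of_finite_measure k)).
have nuE j A : measurable A -> nu j A = (l A - (t j)%:E * k A)%E.
  by move=> _; rewrite -[LHS]/(l A + (- t j)%:E * k A)%E EFinN mulNe.
have /choice[P /choice[N PN]] j : exists P N, hahn_decomposition (nu j) P N.
  exact: Hahn_decomposition.
have mP j : measurable (P j) by have [[]] := PN j.
have mN j : measurable (N j) by have [_ []] := PN j.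
have fk A : measurable A -> k A \is a fin_num by exact: fin_num_measure.
have kP j : k (P j) = 0%E.
  apply: contrapT => kPj; apply: nP; exists (t j), (P j); split => //.
    by rewrite lt0e measure_ge0 andbT; exact/eqP.
  move=> A mA AP; have [[_ pos] _ _ _] := PN j.
  have := pos A mA AP; rewrite nuE// subre_ge0//.
  exact: fin_num_measure.
exists (~` \bigcup_j P j); split; first by apply: measurableC;
  exact: bigcup_measurable.
- apply/eqP; rewrite eq_le measure_ge0 andbT; apply/lee_addgt0Pr => e e0.
  rewrite add0e.
  have [j je] : exists j, t j * fine (k setT) < e.
    have [j] : exists j : nat, fine (k setT) / e < j%:R.
      by exists (Num.truncn (fine (k setT) / e)).+1; exact: truncnS_gt.
    rewrite ltr_pdivrMr// => kj; exists j; rewrite mulrC ltr_pdivrMr ?ltr0n//.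
    by rewrite (lt_le_trans kj)// mulrC ler_wpM2l ?ler_nat// ltW.
  have [_ [_ neg] PNT _] := PN j.
  apply: (@le_trans _ _ (l (N j))).
    apply: le_measure; rewrite ?inE//.
      by apply: measurableC; exact: bigcup_measurable.
    move=> x nPx; have : (P j `|` N j) x by rewrite PNT.
    by case=> // Px; exfalso; apply: nPx; exists j.
  have := neg (N j) (mN j); rewrite nuE//.
  rewrite leeBlDr; last by rewrite fin_numM// fk.
  rewrite add0e => /(_ (fun x => id))/le_trans; apply.
  apply: (@le_trans _ _ ((t j)%:E * k setT)%E); last first.
    by rewrite -(fineK (fk _ measurableT)) -EFinM lee_fin ltW.
  apply: lee_wpmul2l; first by rewrite lee_fin ltW.
  by apply: le_measure; rewrite ?inE.
- rewrite setCK; exact: null_bigcup.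
Qed.

(** If [l] were singular with respect to each restriction of [m] to [F i], the
    union of the corresponding sets would witness that it is singular with
    respect to [m]. *)
Lemma not_singular_minorized_sigma_finite d (T : measurableType d)
    (R : realType)
    (l : {finite_measure set T -> \bar R}) (m : {measure set T -> \bar R})
    (F : (set T)^nat) :
  \bigcup_i F i = setT -> (forall i, measurable (F i)) ->
  (forall i, (m (F i) < +oo)%E) -> ~ mutually_singular l m ->
  exists (i : nat) (t : R) (P : set T),
    [/\ 0 < t, measurable P, P `<=` F i, (0 < m P)%E &
    forall A, measurable A -> A `<=` P -> (t%:E * m A <= l A)%E].
Proof.
move=> FT mF fF nsing.
pose k i : {finite_measure set T -> \bar R} := mfrestr (mF i) (fF i).
have kE i A : k i A = m (A `&` F i) by [].
have [[i nsi]|sing] := pselect (exists i, ~ mutually_singular l (k i)).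
  have [t [P [t0 mP kP tk]]] := not_singular_minorized nsi.
  exists i, t, (P `&` F i); split => //; first exact: measurableI.
  move=> A mA AP; have AF : A `<=` F i by move=> x /AP[].
  have := tk A mA; rewrite kE (setIidl AF); apply; by move=> x /AP[].
have /choice[A PA] i : exists A,
  [/\ measurable A, l A = 0%E & k i (~` A) = 0%E].
  by apply: contrapT => H; apply: sing; exists i.
exfalso; apply: nsing; exists (\bigcup_i A i).
have mA i : measurable (A i) by have [] := PA i.
split; first exact: bigcup_measurable.
- by apply: null_bigcup => // j; have [] := PA j.
- have mC : measurable (~` \bigcup_i A i) by apply: measurableC;
  exact: bigcup_measurable.
  apply/negligibleP => //; rewrite -[X in negligible _ X]setIT -FT setI_bigcupr.
  apply: negligible_bigcup => i; apply/negligibleP; first exact: measurableI.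
  have [_ _] := PA i; rewrite kE => H; apply: subset_measure0 H.
  + exact: measurableI.
  + by apply: measurableI => //; exact: measurableC.
  + by move=> x [nAx Fx]; split => // Ax; apply: nAx; exists i.
Qed.

Section right_haar.
Context (R : realType) (G : topologicalGroupType).
Hypotheses (sigma_compactG : sigma_compact G) (metG : metrizable R G).

Lemma invg_setK (A : set G) :
  (fun h : G => (h^-1)%g) @^-1` ((fun h : G => (h^-1)%g) @^-1` A) = A.
Proof. by apply/seteqP; split=> h /=; rewrite invgK. Qed.

Lemma invg_compact (K : set G) : compact K ->
  compact ((fun h : G => (h^-1)%g) @^-1` K).
Proof.
move=> cK; rewrite (_ : _ @^-1` _ = (fun h : G => (h^-1)%g) @` K).
  by apply: continuous_compact => //; apply: continuous_subspaceT;
    exact: invg_continuous.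
apply/seteqP; split=> [h Kh|_ [h Kh <-]]; last by rewrite /= invgK.
by exists (h^-1)%g => //; rewrite invgK.
Qed.

Lemma invg_open (U : set G) : open U -> open ((fun h : G => (h^-1)%g) @^-1` U).
Proof. by move: U; apply/continuousP; exact: invg_continuous. Qed.

(** For [k] one takes the right Haar measure that maps [A] to the measure of
    its inverse; it has the null sets of [m] by [haar_null_invg], so [l] is not
    singular to it. Right invariance is what suits the translations of the
    starting point of the walk. *)
Lemma not_singular_haar_minorized (m : {measure set (borel G) -> \bar R})
    (l : {finite_measure set (borel G) -> \bar R}) :
  haar m -> ~ mutually_singular l m ->
  exists (k : {measure set (borel G) -> \bar R}) (t : R) (K : set G),
  [/\ 0 < t /\ compact K, (0 < k K < +oo)%E,
   (forall (g : G) (A : set (borel G)), measurable A ->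
     k ((fun h : G => (h * g)%g) @^-1` A) = k A),
   (forall A : set (borel G), measurable A -> A `<=` K ->
     (t%:E * k A <= l A)%E) &
   forall e : R, 0 < e -> exists O : set G,
     [/\ open O, K `<=` O & (k O <= k K + e%:E)%E]].
Proof.
move=> hm nsing; have [[fm om _] m0 im] := hm.
pose iv : borel G -> borel G := fun h : G => (h^-1)%g.
have miv : measurable_fun setT iv by exact: measurable_invg.
pose push : {measure set (borel G) -> \bar R} := pushforward m iv.
pose k : {measure set (borel G) -> \bar R} := push miv.
have kE A : k A = m (iv @^-1` A) by [].
have mpre (A : set (borel G)) : measurable A -> measurable (iv @^-1` A).
  exact: measurable_preimage.
have ksing : ~ mutually_singular l k.
  move=> [A [mA lA kA]]; apply: nsing; exists A; split => //.
  rewrite -[~` A]invg_setK; apply: (haar_null_invg sigma_compactG metG hm) =>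
    //.
  by apply: mpre; exact: measurableC.
have [C [cC UC]] := sigma_compactG.
have mC i : measurable (iv @^-1` (C i)) by apply: mpre;
  exact: (compact_borel metG).
have [i [t [P [t0 mP PC kP tk]]]] :
    exists (i : nat) (t : R) (P : set (borel G)),
      [/\ 0 < t, measurable P, P `<=` iv @^-1` (C i),
    (0 < k P)%E & forall A, measurable A -> A `<=` P -> (t%:E * k A <= l A)%E].
  apply: not_singular_minorized_sigma_finite => //.
    by rewrite -preimage_bigcup UC preimage_setT.
  by move=> i; rewrite kE invg_setK; exact: fm.
pose Q := iv @^-1` P.
have mQ : measurable Q by exact: mpre.
have mCi : measurable (C i : set (borel G)) by exact: compact_borel metG _ _.
have QC : Q `<=` C i by move=> h /PC; rewrite /= /iv invgK.
have fCi : (m (C i) < +oo)%E by exact: fm.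
have fQ : m Q \is a fin_num.
  by rewrite ge0_fin_numE//; apply: le_lt_trans fCi; apply: le_measure;
    rewrite ?inE.
(* Inner regularity: removing from the compact set [C i] an open set slightly
   larger than the complement of [Q] leaves a compact subset of [Q]. *)
have [W [oO CO mO]] : exists W : set G,
    [/\ open W, C i `\` Q `<=` W & (m W < m (C i))%E].
  have mCQ : (m (C i) = m (C i `\` Q) + m Q)%E.
    by rewrite measureD// setIidr// subeK.
  have := om (C i `\` Q) (measurableD mCi mQ) => omE.
  have /ereal_inf_lt[_ [W [oO CO] <-] mO] :
      (ereal_inf [set m U | U in [set U : set G | open U /\ C i `\` Q `<=` U]] <
        m (C i))%E.
    rewrite -omE mCQ lteDl//;
      first by rewrite ge0_fin_numE// (le_lt_trans _ fCi)// le_measure ?inE//;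
      exact: measurableD.
  by exists W.
pose L := C i `\` W.
have mO' : measurable (W : set (borel G)) by exact: open_borel.
have mL : measurable (L : set (borel G)) by exact: measurableD.
have cL : compact L.
  apply: (@subclosed_compact _ _ (C i)) => //; last by move=> x [].
  rewrite /L setDE; apply: closedI; last exact: open_closedC.
  by apply: compact_closed => //; exact: metrizable_hausdorff metG.
have LQ : L `<=` Q by move=> x [Cx nOx]; apply: contrapT => nQx; apply: nOx;
  exact: CO.
have mL0 : (0 < m L)%E.
  rewrite lt0e measure_ge0 andbT; apply/eqP => L0.
  move: mO; rewrite ltNge => /negP; apply.
  rewrite -[leRHS]add0e -L0.
  apply: le_trans (measureU2 _ _ _) => //.
  apply: le_measure; rewrite ?inE//; first exact: measurableU.
  by move=> x Cx; have [Ox|nOx] := pselect (W x); [right|left].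
have kL : k (iv @^-1` L) = m L by rewrite kE invg_setK.
have fL : (m L < +oo)%E by apply: le_lt_trans fCi; apply: le_measure;
  rewrite ?inE// => x [].
exists k, t, (iv @^-1` L); split.
- by split => //; exact: invg_compact.
- by rewrite kL mL0.
- move=> g A mA; rewrite !kE -(im (g^-1)%g (iv @^-1` A)); last exact: mpre.
  by congr (m _); apply/seteqP; split=> x; rewrite /iv/= invgM invgK.
- move=> A mA AL; apply: tk => // x /AL /LQ; by rewrite /Q /= /iv invgK.
- move=> e e0; have
  Le : (ereal_inf [set m U | U in [set U : set G | open U /\ L `<=` U]] < m L +
  e%:E)%E.
    by rewrite -om// lteDl// ge0_fin_numE.
  have [_ [U [oU LU] <-] mU] := ereal_inf_lt Le.
  exists (iv @^-1` U); split; first exact: invg_open.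
    by move=> x /LU.
  by rewrite kL kE invg_setK ltW.
Qed.

End right_haar.

(** * Equicontinuity under right translations *)

(** Continuity at 1 of the right translates of [a] in total variation, stated
    by duality; for finite [a], exchanging [f] and [1 - f] shows that the
    one-sided bound suffices. *)
Definition translation_continuous (R : realType) (G : topologicalGroupType)
    (a : {measure set (borel G) -> \bar R}) :=
  forall e : R, 0 < e -> \forall g \near (1%g : G),
    forall f : borel G -> \bar R, measurable_fun setT f ->
      (forall h, (0 <= f h <= 1)%E) ->
      (\int[a]_h f ((h : G) * g)%g <= \int[a]_h f h + e%:E)%E.

Section translations.
Context (R : realType) (G : topologicalGroupType).
Hypotheses (sigma_compactG : sigma_compact G) (metG : metrizable R G).
Let scG : @second_countable G :=
  sigma_compact_second_countable metG sigma_compactG.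

(** The tube lemma around the slice at 1. *)
Lemma near1_compact (K : set G) (f : G * G -> G) (U : set G) :
  compact K -> continuous f -> open U -> (forall h, K h -> U (f (h, 1%g))) ->
  \forall g \near (1%g : G), forall h, K h -> U (f (h, g)).
Proof.
move=> cK cf oU KU.
have := (compact_near_coveringP K).1 cK G (nbhs (1%g : G)) (fun g h =>
  U (f (h, g))).
move=> /(_ _); apply => h Kh.
have /cf : nbhs (f (h, 1%g)) U by apply: open_nbhs_nbhs; split => //; exact: KU.
by move=> [[P Q] PQ PQU]; exists (P, Q) => // -[x y]; exact: PQU.
Qed.

(** Let [U] be an open set containing [K] with [k (U \` K)] small. For [g] near
    1, the translate of [K] by [g] stays inside [U], so the translate of [a] by
    [g] is at most [a] plus the small mass of [t k] on [U \` K]. *)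
Lemma translation_continuous_restr (k : {measure set (borel G) -> \bar R})
    (t : R)
    (K : set G) (mK : measurable (K : set (borel G)))
    (a : {measure set (borel G) -> \bar R}) :
  0 <= t -> compact K -> (k K < +oo)%E ->
  (forall (g : G) (A : set (borel G)), measurable A ->
     k ((fun h : G => (h * g)%g) @^-1` A) = k A) ->
  (forall e : R, 0 < e -> exists O : set G,
     [/\ open O, K `<=` O & (k O <= k K + e%:E)%E]) ->
  (forall A : set (borel G), a A = t%:E * k (A `&` K))%E ->
    translation_continuous a.
Proof.
move=> t0 cK fK ik outer aE e e0.
pose s : R := e / (t + 1).
have s0 : 0 < s by rewrite divr_gt0// ltr_wpDl.
have [U [oU KU kU]] := outer s s0.
have mU : measurable (U : set (borel G)) by exact: open_borel.
have mUK : measurable (U `\` K : set (borel G)) by exact: measurableD.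
have kUK : (k (U `\` K) <= s%:E)%E.
  have UE : (k U = k (U `\` K) + k K)%E.
    by rewrite -[in LHS](setDUK KU) measureU ?setDIK// addeC.
  by move: kU; rewrite UE addeC leeD2lE// ge0_fin_numE.
have near1 : \forall g \near (1%g : G), forall h, K h -> U (h * g)%g.
  apply: (near1_compact (f := fun p => (p.1 * p.2)%g)) => //.
    exact: mulg_continuous.
  by move=> h /KU; rewrite /= mulg1.
near=> g => f mf f01.
have Kg : forall h, K h -> U (h * g)%g by near: g.
have f0 h : (0 <= f h)%E by have /andP[] := f01 h.
have f1 h : (f h <= 1)%E by have /andP[] := f01 h.
pose push : {measure set (borel G) -> \bar R} :=
  pushforward a (fun h : borel G => ((h : G) * g)%g : borel G).
pose ag : {measure set (borel G) -> \bar R} := push (measurable_mulgr scG g).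
pose tt : {nonneg R} := NngNum t0.
pose b : {measure set (borel G) -> \bar R} := mscale tt (mrestr k mUK).
have bE A : b A = (t%:E * k (A `&` (U `\` K)))%E by [].
have agab A : measurable A -> (ag A <= measure_add a b A)%E.
  move=> mA; rewrite measure_addE bE -[ag A]/(a _) !aE.
  rewrite -ge0_muleDr//.
  apply: lee_wpmul2l; first by rewrite lee_fin.
  apply: (@le_trans _ _ (k (A `&` U))); last first.
    apply: le_trans (measureU2 _ _ _); rewrite -?setIUr ?setDUK//;
     by apply: measurableI.
  rewrite -(ik g (A `&` U)); last exact: measurableI.
  apply: le_measure; rewrite ?inE.
  - by apply: measurableI => //; exact: measurable_preimage_mulgr.
  - by apply: measurable_preimage_mulgr => //; exact: measurableI.
  - by move=> h [Ah Kh]; split => //; exact: Kg.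
have -> : (\int[a]_h f ((h : G) * g)%g = \int[ag]_h f h)%E.
  by have -> := ge0_integral_pushforward (measurable_mulgr scG g) a
    measurableT mf (fun y _ => f0 y).
apply: (@le_trans _ _ (\int[measure_add a b]_h f h)%E).
  exact: ge0_le_measure_integral.
rewrite ge0_integral_measure_add//; apply: leeD2l.
apply: (@le_trans _ _ (\int[b]_h (cst 1 h))%E); first exact: ge0_le_integral.
rewrite integral_cst// mul1e bE setTI.
apply: (@le_trans _ _ (t%:E * s%:E)%E).
  by apply: lee_wpmul2l => //; rewrite lee_fin.
rewrite -EFinM lee_fin /s mulrCA -[leRHS]mulr1 ler_pM2l//.
by rewrite ler_pdivrMr ?mul1r ?lerDl// ltr_wpDl.
Unshelve. all: by end_near. Qed.

End translations.

Section equicontinuity.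
Context (R : realType) (G : topologicalGroupType).
Hypotheses (sigma_compactG : sigma_compact G) (metG : metrizable R G).
Let scG : @second_countable G :=
  sigma_compact_second_countable metG sigma_compactG.

Lemma not_singular_translation_continuous
    (m : {measure set (borel G) -> \bar R})
    (l : {finite_measure set (borel G) -> \bar R}) :
  haar m -> ~ mutually_singular l m ->
  exists a : {finite_measure set (borel G) -> \bar R},
  [/\ (0 < a setT)%E, (forall A, measurable A -> (a A <= l A)%E) &
      translation_continuous a].
Proof.
move=> hm /(not_singular_haar_minorized sigma_compactG metG hm).
move=> [k [t [K [[t0 cK] /andP[kK0 fK] ik kl outer]]]].
have mK := compact_borel metG cK.
pose tt : {nonneg R} := NngNum (ltW t0).
pose a : {finite_measure set (borel G) -> \bar R} := mscale tt (mfrestr mK fK).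
have aE A : a A = (t%:E * k (A `&` K))%E by [].
exists a; split.
- by rewrite aE setTI mule_gt0.
- move=> A mA; rewrite aE.
  have mAK : measurable (A `&` K : set (borel G)) by exact: measurableI.
  apply: le_trans (kl _ mAK (@subIsetr _ _ _)) _.
  by apply: le_measure; rewrite ?inE// => x [].
- by apply: (translation_continuous_restr sigma_compactG metG mK
  (ltW t0) cK fK ik outer aE).
Qed.

Lemma finite_measure_tight (l : {finite_measure set (borel G) -> \bar R})
    (e : R) : 0 < e ->
  exists2 C : set G, compact C & (l (~` C) <= e%:E)%E.
Proof.
move=> e0; have [K [cK UK]] := sigma_compactG.
pose C n : set (borel G) := \big[setU/set0]_(i < n.+1) K i.
have cC n : compact (C n : set G) by exact: bigsetU_compact.
have mC n : measurable (C n) by exact: compact_borel metG _ (cC n).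
have : l \o (fun n => ~` C n) @ \oo --> l (\bigcap_n ~` C n).
  apply: nonincreasing_cvg_mu.
  - by rewrite -ge0_fin_numE// fin_num_measure//; exact: measurableC.
  - by move=> n; exact: measurableC.
  - by apply: bigcapT_measurable => n; exact: measurableC.
  - by move=> m n mn; apply/subsetPset; apply: subsetC; exact: subset_bigsetU.
rewrite -setC_bigcup bigcup_bigsetU_bigcup UK setCT measure0.
move=> /fine_cvgP[_ /cvgr0Pnorm_le/(_ _ e0)[n _ /(_ n (leqnn n))]] /=.
rewrite ger0_norm ?fine_ge0// => ln; exists (C n) => //.
by rewrite -lee_fin fineK// in ln; apply: fin_num_measure; exact: measurableC.
Qed.

Context (mu : probability (borel G) R).
Local Notation p := (convolution_power metG mu).

(** One-sided bound for the distance between [p n] and its translate by [g];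
    complements give the other side. *)
Definition translation_close n (r : R) :=
  \forall g \near (1%g : G), forall B : set (borel G), measurable B ->
    (p n ((fun h : G => (h * g)%g) @^-1` B) <= p n B + r%:E)%E.

Lemma measurable_translates (q : {finite_measure set (borel G) -> \bar R})
    (B : set (borel G)) :
  measurable B -> measurable_fun setT (fun g : borel G =>
    q ((fun h : G => (h * g)%g) @^-1` B)).
Proof.
move=> mB; pose C := [set z : borel G * borel G | B ((z.2 : G) * z.1 : G)%g].
have mC : measurable C.
  suff mf : measurable_fun setT (fun z : borel G * borel G =>
      ((z.2 : G) * z.1 : G)%g : borel G) by exact: (measurable_preimage mf mB).
  exact: measurable_mulg.
exact: (measurable_section q mC).
Qed.

(** Condition on the product [h] of the first [n0] steps, of law [l = p n0].
    Translating by [g] before these steps amounts to translating by [h * g *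
    h^-1] after them, and this element is close to 1 when [h] is in a compact
    set [C] that carries almost all of [l]. Hence the integrand in [h] changes
    by at most [r]. On the part [a] of [l], its integral even changes by at
    most [e], which saves [r] times the mass of [a]. The other error [e] is the
    mass outside [C]. *)
Lemma translation_close_step n n0 (a : {finite_measure set (borel G) -> \bar R})
    (r e : R) :
  (forall A, measurable A -> (a A <= p n0 A)%E) -> translation_continuous a ->
  0 <= r -> 0 < e -> translation_close n r ->
  translation_close (n + n0) (r * (1 - fine (a setT)) + 2 * e).
Proof.
move=> al tca r0 e0 closen.
have [C cC lC] := finite_measure_tight (p n0) e0.
have mC := compact_borel metG cC.
move: closen; rewrite {1}/translation_close /prop_near1 nbhsE =>
  -[V [oV V1] VP].
have nearC : \forall g \near (1%g : G), forall h, C h -> V (h * g * h^-1)%g.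
  apply: (near1_compact (f := fun p => (p.1 * p.2 * p.1^-1)%g)) => //.
    apply: continuous_mulg; last by move=> x; apply: continuous_comp;
      [exact: cvg_fst|exact: invg_continuous].
    by apply: continuous_mulg => x; [exact: cvg_fst|exact: cvg_snd].
  by move=> h _; rewrite /= mulg1 mulgV.
near=> g => B mB.
have gC : forall h, C h -> V (h * g * h^-1)%g by near: g.
have ga : forall f : borel G -> \bar R, measurable_fun setT f ->
      (forall h, (0 <= f h <= 1)%E) ->
      (\int[a]_h f ((h : G) * g)%g <= \int[a]_h f h + e%:E)%E.
  by near: g; exact: tca.
have mBg : measurable ((fun h : G => (h * g)%g) @^-1` B : set (borel G)).
  exact: measurable_preimage_mulgr.
rewrite !convolution_powerD//.
move: (p n0) lC al => l lC al.
pose f (h : borel G) := p n ((fun x : G => (x * h)%g) @^-1` B).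
pose f' (h : borel G) :=
  p n ((fun x : G => (x * h)%g) @^-1` ((fun x : G => (x * g)%g) @^-1` B)).
have f'E h : f' h = f ((h : G) * g)%g.
  by congr (p n _); apply/seteqP; split=> x; rewrite /= mulgA.
have mf : measurable_fun setT f by exact: measurable_translates.
have mf' : measurable_fun setT f' by exact: measurable_translates.
have mpre h := @measurable_preimage_mulgr _ scG h.
have f0 h : (0 <= f h)%E by [].
have f'0 h : (0 <= f' h)%E by [].
have f1 h : (f h <= 1)%E by apply: probability_le1; exact: mpre.
(* The bound for [f' - f]: it is [r] on [C], where the bound for [p n] applies,
   and at least 1 elsewhere. *)
pose c (h : borel G) : \bar R := (r + \1_(~` C) h)%:E.
have c0 h : (0 <= c h)%E by rewrite lee_fin addr_ge0.
have mc : measurable_fun setT c.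
  apply/measurable_EFinP; apply: measurable_funD => //.
  by apply: measurable_indic; exact: measurableC.
have f'le h : (f' h <= c h + f h)%E.
  have [Ch|nCh] := pselect (C h).
    rewrite /c indicE memNset//= addr0 addeC.
    have := VP _ (gC h Ch) _ (mpre h B mB); congr (_ <= _)%E.
    by congr (p n _); apply/seteqP; split=> x; rewrite /= !mulgA mulgVK.
  apply: (@le_trans _ _ 1%E); first by rewrite f'E.
  rewrite /c indicE mem_set//= (@le_trans _ _ (r + 1)%:E) ?leeDl//.
  by rewrite lee_fin lerDr.
have f'fin h : f' h \is a fin_num.
  by apply: (fin_num_measure (p n)); exact: (mpre h _ mBg).
(* As [w] is nonnegative, its integral against [a] is at most its integral
   against [l]; the six other integrals are compared through this inequality. *)
pose w h := (c h + f h - f' h)%E.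
have w0 h : (0 <= w h)%E by rewrite sube_ge0// f'fin.
have mw : measurable_fun setT w.
  by apply: emeasurable_funB => //; exact: emeasurable_funD.
have wE h : (c h + f h = w h + f' h)%E.
  by rewrite subeK.
have intE (q : {finite_measure set (borel G) -> \bar R}) :
    (\int[q]_h c h + \int[q]_h f h = \int[q]_h w h + \int[q]_h f' h)%E.
  rewrite -!ge0_integralD//; exact: eq_integral.
have fina (q : {finite_measure set (borel G) -> \bar R}) u :
    measurable_fun setT u -> (forall h, (0 <= u h)%E) ->
      (forall h, (u h <= (r + 2)%:E)%E) ->
    (\int[q]_h u h)%E \is a fin_num.
  move=> mu_ u0 u1; rewrite ge0_fin_numE; last exact: integral_ge0.
  apply: (@le_lt_trans _ _ (\int[q]_h cst (r + 2)%:E h)%E).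
    exact: ge0_le_integral.
  rewrite integral_cst//.
  by rewrite lte_mul_pinfty// ?lee_fin ?addr_ge0// ltey_eq fin_num_measure.
have c1 h : (c h <= (r + 1)%:E)%E.
  by rewrite lee_fin lerD2l indicE; case: (_ \in _).
have w2 h : (w h <= (r + 2)%:E)%E.
  rewrite leeBlDr// (@le_trans _ _ ((r + 1)%:E + 1%:E)%E)//; first exact: leeD.
  by rewrite -EFinD -addrA leeDl.
have r12 : ((r + 1)%:E <= (r + 2)%:E :> \bar R)%E by rewrite lee_fin lerD2l
  ler1n.
have r02 : (1 <= (r + 2)%:E :> \bar R)%E by rewrite lee_fin; lra.
have exE (q : {finite_measure set (borel G) -> \bar R}) u :
    measurable_fun setT u -> (forall h, (0 <= u h)%E) ->
      (forall h, (u h <= (r + 2)%:E)%E) ->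
    exists x : R, (\int[q]_h u h)%E = x%:E.
  by move=> mu_ u0 u1; exists (fine (\int[q]_h u h)%E); rewrite fineK//;
    exact: fina.
have := intE l; have := intE a.
have f'1 h : (f' h <= 1)%E by rewrite f'E.
have awlw : (\int[a]_h w h <= \int[l]_h w h)%E by
  exact: ge0_le_measure_integral.
have af'af : (\int[a]_h f' h <= \int[a]_h f h + e%:E)%E.
  under eq_integral do rewrite f'E.
  by apply: ga => // h; rewrite f0 f1.
have acr : (r%:E * a setT <= \int[a]_h c h)%E.
  rewrite -integral_cst//; apply: ge0_le_integral => //= h _.
  by rewrite lee_fin lerDl.
have lcr : (\int[l]_h c h <= (r + e)%:E)%E.
  rewrite /c; under eq_integral do rewrite EFinD.
  rewrite ge0_integralD//; last first.
    by apply/measurable_EFinP; apply: measurable_indic; exact: measurableC.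
  rewrite integral_cst// integral_indic//; last exact: measurableC.
  rewrite EFinD; apply: leeD; last by rewrite setIT.
  apply: (@le_trans _ _ (r%:E * 1)%E); last by rewrite mule1.
  by apply: lee_wpmul2l; [rewrite lee_fin|exact: probability_le1].
have [lc lcE] := exE l c mc c0 (fun h => le_trans (c1 h) r12).
have [ac acE] := exE a c mc c0 (fun h => le_trans (c1 h) r12).
have [lf lfE] := exE l f mf f0 (fun h => le_trans (f1 h) r02).
have [af afE] := exE a f mf f0 (fun h => le_trans (f1 h) r02).
have [lf' lf'E] := exE l f' mf' f'0 (fun h => le_trans (f'1 h) r02).
have [af' af'E] := exE a f' mf' f'0 (fun h => le_trans (f'1 h) r02).
have [lw lwE] := exE l w mw w0 w2.
have [aw awE] := exE a w mw w0 w2.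
have aT : a setT = (fine (a setT))%:E by rewrite fineK//;
  exact: fin_num_measure.
move: awlw af'af acr lcr; rewrite -/f -/f'.
rewrite lcE acE lfE afE lf'E af'E lwE awE aT -!EFinM -!EFinD.
rewrite !lee_fin => awlw af'af acr lcr [aeq] [leq].
by rewrite mulrBr mulr1; lra.
Unshelve. all: by end_near. Qed.

End equicontinuity.

Section equicontinuity_iterated.
Context (R : realType) (G : topologicalGroupType).
Hypotheses (sigma_compactG : sigma_compact G) (metG : metrizable R G).
Let scG : @second_countable G :=
  sigma_compact_second_countable metG sigma_compactG.
Context (mu : probability (borel G) R).
Local Notation p := (convolution_power metG mu).

(** Further steps act on the left, so they commute with right translations. *)
Lemma translate_leS (g : G) (r : R) n : 0 <= r ->
  (forall B : set (borel G), measurable B ->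
    (p n ((fun h : G => (h * g)%g) @^-1` B) <= p n B + r%:E)%E) ->
  forall B : set (borel G), measurable B ->
    (p n.+1 ((fun h : G => (h * g)%g) @^-1` B) <= p n.+1 B + r%:E)%E.
Proof.
move=> r0 le_n B mB; rewrite !convolution_powerS.
move: (p n) le_n => q le_n.
have mq (A : set (borel G)) : measurable A -> measurable_fun setT
    (fun h : borel G => q ((fun x : G => (h * x)%g) @^-1` A)).
  by move=> mA; exact: (measurable_fun_act metG (@mulg_continuous G)).
have mBg : measurable ((fun h : G => (h * g)%g) @^-1` B : set (borel G)).
  exact: measurable_preimage_mulgr.
apply: (@le_trans _ _
  (\int[mu]_h (q ((fun x : G => (h * x)%g) @^-1` B) + r%:E))%E).
  apply: ge0_le_integral => //.
  - exact: mq.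
  - by apply: emeasurable_funD => //; exact: mq.
  - move=> h _; have := le_n _ (measurable_preimage_mulgl scG h mB).
    congr (_ <= _)%E; congr (q _).
    by apply/seteqP; split=> x; rewrite /= mulgA.
rewrite ge0_integralD//; last exact: mq.
apply: leeD => //; rewrite integral_cst//.
apply: (@le_trans _ _ (r%:E * 1)%E); last by rewrite mule1.
by apply: lee_wpmul2l; [rewrite lee_fin|exact: probability_le1].
Qed.

Lemma translate_le_mono (g : G) (r : R) n k : 0 <= r -> (n <= k)%N ->
  (forall B : set (borel G), measurable B ->
    (p n ((fun h : G => (h * g)%g) @^-1` B) <= p n B + r%:E)%E) ->
  forall B : set (borel G), measurable B ->
    (p k ((fun h : G => (h * g)%g) @^-1` B) <= p k B + r%:E)%E.
Proof.
move=> r0 /subnK <-; elim: (k - n)%N => [//|i ih] le_n.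
rewrite addSn; apply: translate_leS => //; exact: ih.
Qed.

(** Starting from the trivial bound 1, each use of [translation_close_step]
    brings the bound closer to 0, geometrically up to an arbitrarily small
    error. *)
Lemma spread_out_equicontinuous (e : R) : spread_out metG mu -> 0 < e ->
  exists N, \forall g \near (1%g : G), forall n, (N <= n)%N ->
    forall B : set (borel G), measurable B ->
    (p n ((fun h : G => (h * g)%g) @^-1` B) <= p n B + e%:E)%E.
Proof.
move=> [m [n0 [hm _ nsing]]] e0.
have [a [a0 al tca]] :=
  not_singular_translation_continuous sigma_compactG metG hm nsing.
have afin : a setT \is a fin_num by exact: fin_num_measure.
pose al1 := fine (a setT).
have al1_0 : 0 < al1 by rewrite fine_gt0// a0 ltey_eq afin.
have al1_1 : al1 <= 1.
  rewrite -lee_fin fineK//; apply: le_trans (al _ measurableT) _.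
  exact: probability_le1.
(* The errors are chosen so that [e / 2] is a fixed point of the affine map
   [r |-> r * (1 - al1) + 2 * (al1 * (e / 4))] applied at each step. *)
have H j : exists n, translation_close metG mu n ((1 - al1) ^+ j + e / 2).
  elim: j => [|j [n closen]].
    exists 0%N; apply: nearW => g B mB; rewrite expr0.
    apply: (@le_trans _ _ 1%E).
      by apply: probability_le1; exact: measurable_preimage_mulgr.
    rewrite (@le_trans _ _ (1 + e / 2)%:E)// ?leeDr//.
    by rewrite lee_fin lerDl divr_ge0 ?ltW.
  exists (n + n0)%N.
  have -> : (1 - al1) ^+ j.+1 + e / 2 =
      ((1 - al1) ^+ j + e / 2) * (1 - al1) + 2 * (al1 * (e / 4)).
    by rewrite exprSr; lra.
  apply: translation_close_step => //.
  - by rewrite addr_ge0// ?exprn_ge0 ?subr_ge0// divr_ge0// ltW.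
  - by rewrite mulr_gt0// divr_gt0.
have [j je] : exists j, (1 - al1) ^+ j <= e / 2.
  have : `|1 - al1| < 1.
    by rewrite ger0_norm ?subr_ge0// gtrBl.
  move=> /cvg_expr/cvgr0Pnorm_le /(_ (e / 2)).
  rewrite divr_gt0// => /(_ isT) [j _ /(_ j (leqnn j))] /= jle.
  by exists j; apply: le_trans jle; exact: ler_norm.
have [N closeN] := H j; exists N; apply: filterS closeN => g gB n Nn.
apply: (translate_le_mono (ltW e0) Nn) => B mB.
apply: le_trans (gB B mB) _; rewrite leeD2l// lee_fin.
by rewrite [leRHS]splitr lerD2r.
Qed.

End equicontinuity_iterated.

(** * Subharmonic functions for a measure preserving walk *)

Section subharmonic.
Context d1 d2 (S : measurableType d1) (Z : measurableType d2) (R : realType).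
Context (sg : probability S R) (m : probability Z R) (act : S * Z -> Z).
Hypothesis mact : measurable_fun setT act.
Hypothesis act_m : forall s A, measurable A -> m [set z | A (act (s, z))] = m A.

Lemma integral_act s (f : Z -> \bar R) : measurable_fun setT f ->
  (forall z, (0 <= f z)%E) -> (\int[m]_z f (act (s, z)) = \int[m]_z f z)%E.
Proof.
move=> mf f0; have ms : measurable_fun setT (fun z => act (s, z)).
  exact: (measurableT_comp mact (pair1_measurable s)).
have := ge0_integral_pushforward ms m measurableT mf (fun y _ => f0 y).
rewrite /= preimage_setT => <-; apply: eq_measure_integral => A mA _.
exact: act_m.
Qed.

(** Let [F (s, z) = D (act (s, z))] and [E (s, z) = D z]. Both have the second
    moment of [D], because [act] preserves [m], and the integral of [F * E] is
    at least this moment, because [D] is subharmonic. Expanding the square, the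
    integral of [(F - E)^2] is at most 0. *)
Lemma subharmonic_invariant (D : Z -> R) : measurable_fun setT D ->
  (forall z, 0 <= D z <= 1) ->
  (forall z, ((D z)%:E <= \int[sg]_s (D (act (s, z)))%:E)%E) ->
  forall W, measurable W -> (forall w, W w -> D (act w) <> D w.2) ->
  (sg \x m)%E W = 0%E.
Proof.
move=> mD D01 sub W mW WD.
have D0 z : 0 <= D z by have /andP[] := D01 z.
have D1 z : D z <= 1 by have /andP[] := D01 z.
pose P : {measure set (S * Z) -> \bar R} := (sg \x m)%E.
pose F (w : S * Z) := D (act w).
pose E (w : S * Z) := D w.2.
have F0 w : 0 <= F w by exact: D0.
have E0 w : 0 <= E w by exact: D0.
have mF : measurable_fun setT F by exact: measurableT_comp.
have mE : measurable_fun setT E by exact: measurableT_comp.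
pose nD := (\int[m]_z (D z * D z)%:E)%E.
have mDD : measurable_fun setT (fun z => (D z * D z)%:E).
  by apply/measurable_EFinP; exact: measurable_funM.
have mFF : measurable_fun setT (fun w => (F w * F w)%:E).
  by apply/measurable_EFinP; exact: measurable_funM.
have mEE : measurable_fun setT (fun w => (E w * E w)%:E).
  by apply/measurable_EFinP; exact: measurable_funM.
have mFE : measurable_fun setT (fun w => (F w * E w)%:E).
  by apply/measurable_EFinP; exact: measurable_funM.
have mFE2 : measurable_fun setT (fun w => ((F w - E w) * (F w - E w))%:E).
  by apply/measurable_EFinP; apply: measurable_funM; exact: measurable_funB.
have sq0 (x : R) : 0 <= x * x by rewrite -expr2 sqr_ge0.
have DD0 z : (0 <= (D z * D z)%:E)%E by rewrite lee_fin.
have intFF : (\int[P]_w (F w * F w)%:E = nD)%E.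
  rewrite fubini_tonelli1//=; last by move=> w; rewrite lee_fin.
  under eq_integral => s _.
    rewrite /fubini_F (integral_act s mDD)//.
    over.
  exact: (integral_cst_probability sg nD).
have intEE : (\int[P]_w (E w * E w)%:E = nD)%E.
  rewrite fubini_tonelli1//=; last by move=> w; rewrite lee_fin.
  exact: (integral_cst_probability sg nD).
have intFE : (nD <= \int[P]_w (F w * E w)%:E)%E.
  have FE0 w : (0 <= (F w * E w)%:E)%E by rewrite lee_fin mulr_ge0.
  rewrite fubini_tonelli2//=; apply: ge0_le_integral => //.
    exact: measurable_fun_fubini_tonelli_G.
  move=> z _; rewrite /fubini_G /E /=.
  under eq_integral do rewrite EFinM.
  rewrite ge0_integralZr//; last 3 first.
  - by apply/measurable_EFinP;
    exact: (measurableT_comp mF (pair2_measurable z)).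
  - by move=> s _; rewrite lee_fin.
  - by rewrite lee_fin.
  by rewrite EFinM; apply: lee_wpmul2r; rewrite ?lee_fin.
have nDfin : nD \is a fin_num.
  rewrite ge0_fin_numE; last exact: integral_ge0.
  apply: (@le_lt_trans _ _ (\int[m]_z (cst 1%E z))%E).
    apply: ge0_le_integral => //= z _.
    by rewrite lee_fin -[leRHS]mulr1 ler_pM.
  by rewrite integral_cst_probability ltry.
have key : (\int[P]_w ((F w - E w) * (F w - E w))%:E = 0)%E.
  have FE0 w : (0 <= (F w * E w)%:E)%E by rewrite lee_fin mulr_ge0.
  have FE2 w : (0 <= ((F w - E w) * (F w - E w))%:E)%E by rewrite lee_fin.
  have FF0 w : (0 <= (F w * F w)%:E)%E by rewrite lee_fin.
  have EE0 w : (0 <= (E w * E w)%:E)%E by rewrite lee_fin.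
  have FFE0 w : (0 <= (F w * E w)%:E + ((F w - E w) * (F w - E w))%:E)%E.
    by rewrite adde_ge0.
  have mFFE : measurable_fun setT
      (fun w => (F w * E w)%:E + ((F w - E w) * (F w - E w))%:E)%E.
    exact: emeasurable_funD.
  have eq1 : (\int[P]_w ((F w * F w)%:E + (E w * E w)%:E) =
     \int[P]_w ((F w * E w)%:E +
       ((F w * E w)%:E + ((F w - E w) * (F w - E w))%:E)))%E.
    by apply: eq_integral => w _; rewrite -!EFinD; congr EFin; ring.
  rewrite !ge0_integralD// intFF intEE in eq1.
  apply/eqP; rewrite eq_le integral_ge0// andbT.
  rewrite -(leeD2lE _ _ nDfin) -(leeD2lE _ _ nDfin) adde0 eq1.
  by apply: leeD => //; exact: leeD.
have /ae_eq_integral_abs : (\int[P]_w `|((F w - E w) * (F w - E w))%:E| = 0)%E.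
  by rewrite -[RHS]key; apply: eq_integral => w _; rewrite gee0_abs// lee_fin.
move=> /(_ measurableT mFE2)[N [mN N0 FEN]].
apply: (subset_measure0 _ mN _ N0) => // w Ww; apply: FEN =>
  /= /(_ Logic.I)/eqP.
by rewrite eqe mulf_eq0 orbb subr_eq0 => /eqP; exact: WD.
Qed.

End subharmonic.

(** * The action on the coset space *)

Section coset_action.
Context (G : topologicalGroupType) (Gamma : groupClosed G).
Local Notation X := (coset_space Gamma).
Local Notation act := (@coset_act G Gamma).

Lemma coset_piK (x : X) : exists h, coset_pi Gamma h = x.
Proof. by exists (repr (x : quotient_topology {eq_quot coset_rel Gamma}%qT));
  exact: reprK. Qed.

Lemma coset_act1 x : act 1%g x = x.
Proof. by have [h <-] := coset_piK x; rewrite coset_act_pi mul1g. Qed.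

Lemma coset_actM g h x : act (g * h)%g x = act g (act h x).
Proof. by have [k <-] := coset_piK x; rewrite !coset_act_pi mulgA. Qed.

Lemma coset_actVK g x : act g (act g^-1%g x) = x.
Proof. by rewrite -coset_actM mulgV coset_act1. Qed.

Lemma coset_act_transitive x y : exists g, act g x = y.
Proof.
have [h <-] := coset_piK x; have [k <-] := coset_piK y.
by exists (k * h^-1)%g; rewrite coset_act_pi mulgVK.
Qed.

Lemma nbhs_coset_act (V : set G) x : nbhs (1%g : G) V ->
    nbhs x [set act g x | g in V].
Proof.
have [h <-] := coset_piK x.
rewrite nbhsE => -[U [oU U1] UV]; rewrite nbhsE.
exists (coset_pi Gamma @` ((fun g : G => (g * h^-1)%g) @^-1` U)).
  split; last by exists h; rewrite //= mulgV.
  apply: coset_pi_open; move: U oU {U1 UV}; apply/continuousP.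
  by apply: (@continuous_mulg _ _ id (fun=> h^-1)%g) => y;
    [exact: cvg_id|exact: cvg_cst].
move=> _ [g Ug <-]; exists (g * h^-1)%g; first exact: UV.
by rewrite coset_act_pi mulgVK.
Qed.

Lemma coset_space_second_countable : @second_countable G -> @second_countable X.
Proof.
apply: (open_map_second_countable (f := coset_pi Gamma)).
- exact: coset_pi_continuous.
- exact: coset_pi_open.
- exact: coset_piK.
Qed.

Lemma continuous_act2 (T : topologicalType) (f : T -> G) (h : T -> X) :
  continuous f -> continuous h -> continuous (fun t => act (f t) (h t)).
Proof.
move=> cf ch t; apply: (@continuous_comp _ _ _ (fun t => (f t, h t))
  (fun p : G * X => act p.1 p.2)); last exact: coset_act_continuous.
exact: (cvg_pair (cf t) (ch t)).
Qed.

Lemma continuous_act g : continuous (act g).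
Proof.
apply: (@continuous_act2 _ (fun=> g) id) => x; last exact: cvg_id.
exact: cst_continuous.
Qed.

Hypothesis scG : @second_countable G.

Lemma measurable_act d (T : measurableType d) (f : T -> borel G) (h : T ->
    borel X) :
  measurable_fun setT f -> measurable_fun setT h ->
  measurable_fun setT (fun t => act (f t) (h t) : borel X).
Proof.
move=> mf mh.
have mM : measurable_fun setT
    ((fun p : G * X => act p.1 p.2) : borel G * borel X -> borel X).
  apply: continuous_prod_borel => //; first exact: coset_space_second_countable.
  exact: coset_act_continuous.
exact: (measurableT_comp mM (measurable_fun_pair mf mh)).
Qed.

Lemma measurable_return (A : set (borel X)) x :
  measurable A -> measurable ([set g | A (act g x)] : set (borel G)).
Proof.
move=> mA; suff mf : measurable_fun setT (fun g : borel G => act g x : borel X).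
  exact: (measurable_preimage mf mA).
exact: measurable_act.
Qed.

(** The translates of [U] cover [X] and have the same measure as [U]. *)
Lemma invariant_open_gt0 (R : realType) (m : probability (borel X) R)
    (U : set X) x :
  Defs.invariant act m -> open_nbhs x U -> (0 < m U)%E.
Proof.
move=> im [oU Ux]; rewrite lt0e measure_ge0 andbT; apply/eqP => mU0.
have : m setT = 0%E.
  apply: locally_null => //; first exact: coset_space_second_countable.
  move=> y _; have [g gy] := coset_act_transitive y x.
  exists (act g @^-1` U); split; first split.
  - by move: U oU {Ux mU0}; apply/continuousP; exact: continuous_act.
  - by rewrite /= gy.
  - by rewrite -mU0; apply: im; exact: open_borel.
rewrite [X in X = _ -> _](_ : _ = 1%E); last exact: probability_setT.
by move/eqP; rewrite onee_eq0.
Qed.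

End coset_action.

(** * The asymptotic distance between two starting points *)

Section walk_pseudometric.
Context (R : realType) (G : topologicalGroupType).
Hypotheses (sigma_compactG : sigma_compact G) (metG : metrizable R G).
Let scG : @second_countable G :=
  sigma_compact_second_countable metG sigma_compactG.
Context (mu : probability (borel G) R) (Gamma : groupClosed G).
Local Notation X := (coset_space Gamma).
Local Notation act := (@coset_act G Gamma).
Local Notation p := (convolution_power metG mu).

(** The probability that the walk started at [x] is in [B] at time [n]. *)
Definition hit n (B : set (borel X)) (x : X) : R :=
    fine (p n [set g | B (act g x)]).

Lemma hitE n (B : set (borel X)) x : measurable B ->
  (hit n B x)%:E = p n [set g | B (act g x)].
Proof.
by move=> mB; rewrite fineK//; apply: (fin_num_measure (p n));
  exact: measurable_return.
Qed.

Lemma hit_ge0 n (B : set (borel X)) x : 0 <= hit n B x.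
Proof. by rewrite fine_ge0. Qed.

Lemma hit_le1 n (B : set (borel X)) x : measurable B -> hit n B x <= 1.
Proof.
move=> mB; rewrite -lee_fin hitE//; apply: probability_le1;
  exact: measurable_return.
Qed.

Lemma measurable_hit n (B : set (borel X)) : measurable B ->
  measurable_fun setT (hit n B : borel X -> R).
Proof.
move=> mB; apply/measurable_EFinP.
rewrite (_ : EFin \o _ = fun x => p n [set g | B (act g x)]); last first.
  by apply/funext => x /=; rewrite hitE.
pose C := [set z : borel X * borel G | B (act z.2 z.1)].
have mC : measurable C.
  suff mf : measurable_fun setT (fun z : borel X * borel G =>
    act z.2 z.1 : borel X).
    exact: (measurable_preimage mf mB).
  exact: measurable_act.
exact: (measurable_section (p n) mC).
Qed.

Lemma hitD n k (B : set (borel X)) x : measurable B ->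
  ((hit (n + k) B x)%:E = \int[p k]_g (hit n B (act g x))%:E)%E.
Proof.
move=> mB; rewrite hitE// convolution_powerD//; last exact: measurable_return.
apply: eq_integral => g _; rewrite hitE//; congr (p n _).
by apply/seteqP; split => h /=; rewrite coset_actM.
Qed.

(** Translating the starting point by [g] is translating [p n] by [g] on the
    right. *)
Lemma hit_near (e : R) : spread_out metG mu -> 0 < e ->
  exists N, \forall g \near (1%g : G), forall n (B : set (borel X)) x,
    (N <= n)%N ->
    measurable B -> `|hit n B (act g x) - hit n B x| <= e.
Proof.
move=> so e0.
have [N nearN] := spread_out_equicontinuous sigma_compactG so e0.
exists N; apply: filterS nearN => g gN.
have le1 n (B : set (borel X)) x : (N <= n)%N -> measurable B ->
    hit n B (act g x) <= hit n B x + e.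
  move=> Nn mB; rewrite -lee_fin EFinD !hitE//.
  have := gN n Nn _ (measurable_return scG x mB); congr (_ <= _)%E.
  by congr (p n _); apply/seteqP; split => h /=; rewrite coset_actM.
(* The bound for the complement of [B] is the other half of that for [B]. *)
have hitC n (B : set (borel X)) x : measurable B ->
  hit n (~` B) x = 1 - hit n B x.
  move=> mB; apply: EFin_inj; rewrite EFinB !hitE//; last exact: measurableC.
  by rewrite -probability_setC//; exact: measurable_return.
move=> n B x Nn mB; rewrite ler_norml lerBlDl le1// andbT.
have := le1 n (~` B) x Nn (measurableC mB); rewrite !hitC//; lra.
Qed.

Context (A : nat -> set (borel X)) (mA : forall j, measurable (A j)).

Definition decode (i : nat) : nat * nat := odflt (0%N, 0%N) (unpickle i).

Definition hit_gap k j (z : X * X) : R := `|hit k (A j) z.1 - hit k (A j) z.2|.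

(** The supremum runs over all later times, so that it decreases with [n], and
    over all the sets [A j]. It is indexed by [nat], through an enumeration of
    the pairs, so that it is the supremum of a sequence of measurable
    functions. *)
Definition tail_gap n (z : X * X) : R :=
  sup (range (fun i => hit_gap (n + (decode i).1) (decode i).2 z)).

(** The limit of [tail_gap n] as [n] tends to infinity, see [tail_gap_cvg]. *)
Definition gap (z : X * X) : R := inf (range (tail_gap ^~ z)).

Lemma hit_gap_le1 k j z : hit_gap k j z <= 1.
Proof.
have := hit_ge0 k (A j) z.1; have := hit_ge0 k (A j) z.2.
have := hit_le1 k z.1 (mA j); have := hit_le1 k z.2 (mA j).
by rewrite /hit_gap ler_norml => *; lra.
Qed.

Lemma has_ubound_gap n z :
  has_ubound (range (fun i => hit_gap (n + (decode i).1) (decode i).2 z)).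
Proof. by exists 1 => _ [i _ <-]; exact: hit_gap_le1. Qed.

Lemma hit_gap_le_tail n k j z : (n <= k)%N -> hit_gap k j z <= tail_gap n z.
Proof.
move=> nk; apply: ub_le_sup; first exact: has_ubound_gap.
exists (pickle ((k - n)%N, j)) => //.
by rewrite /decode pickleK /= subnKC.
Qed.

Lemma tail_gap_le n z c : (forall k j, (n <= k)%N -> hit_gap k j z <= c) ->
  tail_gap n z <= c.
Proof.
move=> H; apply: ge_sup;
  first by exists (hit_gap (n + (decode 0).1) (decode 0).2 z), 0%N.
by move=> _ [i _ <-]; apply: H; exact: leq_addr.
Qed.

Lemma tail_gap_ge0 n z : 0 <= tail_gap n z.
Proof. by apply: le_trans (hit_gap_le_tail 0 z (leqnn n));
  exact: normr_ge0. Qed.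

Lemma tail_gap_le1 n z : tail_gap n z <= 1.
Proof. by apply: tail_gap_le => k j _; exact: hit_gap_le1. Qed.

Lemma tail_gap_cvg z : tail_gap ^~ z @ \oo --> gap z.
Proof.
apply: nonincreasing_cvgn.
  move=> m n mn; apply: tail_gap_le => k j nk; apply: hit_gap_le_tail.
  exact: leq_trans mn nk.
by exists 0 => _ [n _ <-]; exact: tail_gap_ge0.
Qed.

Lemma gap_le_tail n z : gap z <= tail_gap n z.
Proof.
apply: ge_inf; last by exists n.
by exists 0 => _ [m _ <-]; exact: tail_gap_ge0.
Qed.

Lemma gap_ge0 z : 0 <= gap z.
Proof. by apply: (cvgr_to_ge (@tail_gap_cvg z)); apply: nearW => n;
  exact: tail_gap_ge0. Qed.

Lemma gap_le1 z : gap z <= 1.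
Proof. exact: le_trans (gap_le_tail 0 z) (tail_gap_le1 0 z). Qed.

Lemma gapxx x : gap (x, x) = 0.
Proof.
apply/eqP; rewrite eq_le gap_ge0 andbT; apply: le_trans (gap_le_tail 0 _) _.
by apply: tail_gap_le => k j _; rewrite /hit_gap subrr normr0.
Qed.

Lemma gapC x y : gap (x, y) = gap (y, x).
Proof.
rewrite /gap (_ : tail_gap ^~ (x, y) = tail_gap ^~ (y, x))//.
apply/funext => n; congr sup; apply/seteqP.
by split=> _ [i _ <-]; exists i => //; rewrite /hit_gap distrC.
Qed.

Lemma gap_triangle y x z : gap (x, z) <= gap (x, y) + gap (y, z).
Proof.
apply: (cvgr_to_ge (cvgD (@tail_gap_cvg (x, y)) (@tail_gap_cvg (y, z)))).
apply: nearW => n /=.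
apply: le_trans (gap_le_tail n _) _; apply: tail_gap_le => k j nk.
apply: le_trans (ler_distD (hit k (A j) y) _ _) _.
apply: lerD; first exact: (hit_gap_le_tail j (x, y) nk).
exact: (hit_gap_le_tail j (y, z) nk).
Qed.

Lemma gap_near (e : R) : spread_out metG mu -> 0 < e ->
  \forall g \near (1%g : G), forall x, gap (act g x, x) <= e.
Proof.
move=> so e0; have [N nearN] := hit_near so e0.
apply: filterS nearN => g gN x; apply: le_trans (gap_le_tail N _) _.
by apply: tail_gap_le => k j Nk; exact: gN.
Qed.

Lemma measurable_tail_gap n : measurable_fun setT
    (tail_gap n : borel X * borel X -> R).
Proof.
have mg k j : measurable_fun setT (hit_gap k j : borel X * borel X -> R).
  apply: measurableT_comp => //; apply: measurable_funB.
    exact: (measurableT_comp (measurable_hit k (mA j)) measurable_fst).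
  exact: (measurableT_comp (measurable_hit k (mA j)) measurable_snd).
have := @measurable_fun_sups _ _ _ setT (fun i =>
  (hit_gap (n + (decode i).1) (decode i).2
   : borel X * borel X -> R)) 0 (fun z _ => has_ubound_gap n z) (fun i =>
     mg _ _).
congr measurable_fun; apply/funext => z; congr sup.
by rewrite /sdrop; apply/seteqP; split=> _ [i _ <-]; exists i.
Qed.

Lemma measurable_gap : measurable_fun setT (gap : borel X * borel X -> R).
Proof.
apply: (measurable_fun_cvg (h := fun n =>
  (tail_gap n : borel X * borel X -> R))).
  exact: measurable_tail_gap.
by move=> z _; exact: tail_gap_cvg.
Qed.

(** Run two independent walks for [n] steps from [z.1] and [z.2], compare their
    continuations by [tail_gap k], and let [k] tend to infinity. *)
Lemma gap_subharmonic n z :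
  ((gap z)%:E <= \int[(p n \x p n)%E]_s (gap (act s.1 z.1, act s.2 z.2))%:E)%E.
Proof.
pose P : probability (borel G * borel G)%type R := (p n \x p n)%E.
have mact2 : measurable_fun setT (fun s : borel G * borel G =>
    (act s.1 z.1, act s.2 z.2) : borel X * borel X).
  by apply: measurable_fun_pair; exact: measurable_act.
have int1 (f : borel G -> \bar R) : measurable_fun setT f ->
  (forall g, (0 <= f g)%E) ->
    (\int[P]_s f s.1 = \int[p n]_g f g)%E.
  move=> mf f0; rewrite fubini_tonelli1//=; last exact: measurableT_comp.
  by apply: eq_integral => g _; exact: (integral_cst_probability (p n) (f g)).
have int2 (f : borel G -> \bar R) : measurable_fun setT f ->
  (forall g, (0 <= f g)%E) ->
    (\int[P]_s f s.2 = \int[p n]_g f g)%E.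
  move=> mf f0; rewrite fubini_tonelli2//=; last exact: measurableT_comp.
  by apply: eq_integral => g _; exact: (integral_cst_probability (p n) (f g)).
have step k : ((tail_gap (k + n) z)%:E <=
    \int[P]_s (tail_gap k (act s.1 z.1, act s.2 z.2))%:E)%E.
  set I := (X in (_ <= X)%E).
  have I1 : (I <= 1)%E.
    rewrite -[leRHS](integral_cst_probability P 1%E); apply: ge0_le_integral =>
      //.
    - by move=> s _; rewrite lee_fin tail_gap_ge0.
    - by apply/measurable_EFinP;
      exact: (measurableT_comp (measurable_tail_gap k) mact2).
    - by move=> s _; rewrite lee_fin tail_gap_le1.
  have I0 : (0 <= I)%E by apply: integral_ge0 => s _;
    rewrite lee_fin tail_gap_ge0.
  have fI : I \is a fin_num by rewrite ge0_fin_numE// (le_lt_trans I1) ?ltry.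
  rewrite -(fineK fI) lee_fin; apply: tail_gap_le => i j kni.
  have [ik kik ->] : exists2 k', (k <= k')%N & i = (k' + n)%N.
    by exists (i - n)%N; [rewrite leq_subRL ?(leq_trans (leq_addl k n))// addnC|
      rewrite subnK// (leq_trans (leq_addl k n))].
  have hE x : ((hit (ik + n) (A j) x)%:E = \int[p n]_g
    (hit ik (A j) (act g x))%:E)%E.
    exact: hitD.
  have mh x : measurable_fun setT (fun g : borel G => hit ik (A j) (act g x)).
    apply: (measurableT_comp (measurable_hit ik (mA j))); exact: measurable_act.
  have mEh x : measurable_fun setT (fun g : borel G =>
    (hit ik (A j) (act g x))%:E).
    by apply/measurable_EFinP; exact: mh.
  have h0 x (g : borel G) : (0 <= (hit ik (A j) (act g x))%:E)%E.
    by rewrite lee_fin hit_ge0.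
  rewrite -lee_fin (fineK fI); apply: (@dist_integral_le _ _ _ P
    (fun s => hit ik (A j) (act s.1 z.1)) (fun s => hit ik (A j) (act s.2 z.2))
    (fun s => tail_gap k (act s.1 z.1, act s.2 z.2))).
  - exact: (measurableT_comp (mh z.1) measurable_fst).
  - exact: (measurableT_comp (mh z.2) measurable_snd).
  - exact: (measurableT_comp (measurable_tail_gap k) mact2).
  - by move=> s; exact: hit_ge0.
  - by move=> s; exact: hit_ge0.
  - by move=> s; exact: (hit_gap_le_tail j (act s.1 z.1, act s.2 z.2) kik).
  - by rewrite hE; exact: (int1 _ (mEh z.1) (h0 z.1)).
  - by rewrite hE; exact: (int2 _ (mEh z.2) (h0 z.2)).
have cv := bounded_cvg_integral (P := P) (f_ := fun k s =>
  tail_gap k (act s.1 z.1, act s.2 z.2))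
  (f := fun s => gap (act s.1 z.1, act s.2 z.2)) _ _ _.
apply: (cvge_ge _ (cv _ _ _)).
- apply: nearW => k; apply: le_trans (step k).
  by rewrite lee_fin gap_le_tail.
- by move=> k; exact: (measurableT_comp (measurable_tail_gap k) mact2).
- by move=> k s; rewrite tail_gap_ge0 tail_gap_le1.
- by move=> s; exact: tail_gap_cvg.
Qed.

End walk_pseudometric.

(** * Invariance of the asymptotic distance *)

Section gap_invariance.
Context (R : realType) (G : topologicalGroupType).
Hypotheses (sigma_compactG : sigma_compact G) (metG : metrizable R G).
Let scG : @second_countable G :=
  sigma_compact_second_countable metG sigma_compactG.
Context (mu : probability (borel G) R) (Gamma : groupClosed G).
Hypothesis so : spread_out metG mu.
Local Notation X := (coset_space Gamma).
Local Notation act := (@coset_act G Gamma).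
Local Notation p := (convolution_power metG mu).
Context (mX : probability (borel X) R) (invX : Defs.invariant act mX).
Context (A : nat -> set (borel X)) (mA : forall j, measurable (A j)).
Local Notation gap := (gap metG mu A).

Lemma gap_dist x y x' y' :
  `|gap (x, y) - gap (x', y')| <= gap (x', x) + gap (y', y).
Proof.
have gt b a c : gap (a, c) <= gap (a, b) + gap (b, c) by exact: gap_triangle.
have gC a b : gap (a, b) = gap (b, a) by exact: gapC.
rewrite ler_norml lerBlDl; apply/andP; split.
  have := gt x x' y'; have := gt y x y'.
  by rewrite (gC y y'); lra.
have := gt x' x y; have := gt y' x' y.
by rewrite (gC x x'); lra.
Qed.

Lemma gap_continuous : continuous (gap : X * X -> R).
Proof.
move=> [x y]; apply/cvgrPdist_le => e e0.
have e2 : 0 < e / 2 by rewrite divr_gt0.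
pose V := [set g : G | forall x, gap (act g x, x) <= e / 2].
have nV : nbhs (1%g : G) V by exact: gap_near.
exists ([set act g x | g in V], [set act g y | g in V]).
  by split; exact: nbhs_coset_act.
move=> [_ _] /= [[g Vg <-] [h Vh <-]]; apply: le_trans (gap_dist _ _ _ _) _.
by rewrite [leRHS]splitr; apply: lerD; [exact: Vg|exact: Vh].
Qed.

Lemma product_invariant (g h : G) (B : set (borel X * borel X)) : measurable
    B ->
  (mX \x mX)%E [set z | B (act g z.1, act h z.2)] = (mX \x mX)%E B.
Proof.
have pE (C : set (borel X * borel X)) :
    (mX \x mX)%E C = (\int[mX]_x mX [set y | C (x, y)])%E.
  apply: eq_integral => x _; congr (mX _).
  by apply/seteqP; split=> y; rewrite /xsection/= inE.
move=> mB; rewrite !pE.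
have mF : measurable_fun setT (fun x : borel X => mX [set y | B (x, y)]).
  exact: (measurable_section mX mB).
have mact : measurable_fun setT (fun w : borel G * borel X =>
  act w.1 w.2 : borel X).
  exact: measurable_act.
have actm (s : borel G) (C : set (borel X)) : measurable C ->
  mX [set z | C (act s z)] = mX C by exact: invX.
rewrite -[RHS](integral_act mact actm g mF)//=; apply: eq_integral => x _.
apply: (invX h (A := [set y | B (act g x, y)])).
exact: (measurable_preimage (pair1_measurable (act g x : borel X)) mB).
Qed.

(** By [subharmonic_invariant] the set of the [((g, h), (x, y))] where the
    equality fails is null. It is open, by continuity of [gap], and every open
    neighbourhood of a point with [g] and [h] in the support of [p n] has
    positive measure. *)
Lemma gap_invariant n g h x y :
  msupport (p n) g -> msupport (p n) h -> gap (act g x, act h y) = gap (x, y).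
Proof.
move=> Sg Sh; apply: contrapT => neq.
pose F (w : (G * G) * (X * X)) : R :=
  gap (act w.1.1 w.2.1, act w.1.2 w.2.2) - gap w.2.
pose Z := ((G * G) * (X * X))%type.
have c11 : continuous (fun w : Z => w.1.1).
  by move=> w; apply: (@continuous_comp _ _ _ fst fst); exact: cvg_fst.
have c12 : continuous (fun w : Z => w.1.2).
  by move=> w; apply: (@continuous_comp _ _ _ fst snd);
    [exact: cvg_fst|exact: cvg_snd].
have c21 : continuous (fun w : Z => w.2.1).
  by move=> w; apply: (@continuous_comp _ _ _ snd fst);
    [exact: cvg_snd|exact: cvg_fst].
have c22 : continuous (fun w : Z => w.2.2).
  by move=> w; apply: (@continuous_comp _ _ _ snd snd); exact: cvg_snd.
have cF : continuous F.
  move=> w; apply: cvgB.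
    apply: (@continuous_comp _ _ _ (fun w : Z =>
      (act w.1.1 w.2.1, act w.1.2 w.2.2)) gap).
      exact: (cvg_pair (continuous_act2 c11 c21 (x := w))
        (continuous_act2 c12 c22 (x := w))).
    exact: gap_continuous.
  apply: (@continuous_comp _ _ _ snd gap); first exact: cvg_snd.
  exact: gap_continuous.
have F0 w : gap (act w.1.1 w.2.1, act w.1.2 w.2.2) = gap w.2 -> F w = 0.
  by rewrite /F => ->; rewrite subrr.
have : \forall w \near (((g, h), (x, y)) : (G * G) * (X * X)), F w != 0.
  apply: (@cvgr_neq0 _ _ _ _ _ F _ (cF ((g, h), (x, y)))).
  by rewrite /F/= subr_eq0; exact/eqP.
move=> /nbhs_prod_open[P [Q [/open_nbhs_nbhs nP /open_nbhs_nbhs nQ PQ]]].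
have [P1 [P2 [Pg Ph P12]]] := nbhs_prod_open nP.
have [Q1 [Q2 [Qx Qy Q12]]] := nbhs_prod_open nQ.
have mP1 : measurable (P1 : set (borel G)) by apply: open_borel; case: Pg.
have mP2 : measurable (P2 : set (borel G)) by apply: open_borel; case: Ph.
have mQ1 : measurable (Q1 : set (borel X)) by apply: open_borel; case: Qx.
have mQ2 : measurable (Q2 : set (borel X)) by apply: open_borel; case: Qy.
pose W1 : set (borel G * borel G) := P1 `*` P2.
pose W2 : set (borel X * borel X) := Q1 `*` Q2.
pose W : set ((borel G * borel G) * (borel X * borel X)) := W1 `*` W2.
have mW1 : measurable W1 by exact: measurableX.
have mW2 : measurable W2 by exact: measurableX.
have mW : measurable W by exact: measurableX.
pose PS : probability (borel G * borel G)%type R := (p n \x p n)%E.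
pose PZ : probability (borel X * borel X)%type R := (mX \x mX)%E.
have W0 : (PS \x PZ)%E W = 0%E.
  apply: (@subharmonic_invariant _ _ (borel G * borel G)%type
    (borel X * borel X)%type R PS PZ
    (fun w => (act w.1.1 w.2.1, act w.1.2 w.2.2)) _ _ gap).
  - apply: measurable_fun_pair; apply: measurable_act => //.
    + exact: (measurableT_comp measurable_fst measurable_fst).
    + exact: (measurableT_comp measurable_fst measurable_snd).
    + exact: (measurableT_comp measurable_snd measurable_fst).
    + exact: (measurableT_comp measurable_snd measurable_snd).
  - by move=> s B mB; exact: product_invariant.
  - exact: measurable_gap.
  - by move=> z; rewrite gap_ge0 ?gap_le1.
  - by move=> z; exact: gap_subharmonic.
  - exact: mW.
  - move=> [[g' h'] [x' y']] [[Pg' Ph'] [Qx' Qy']] /F0; apply/eqP.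
    exact: PQ _ _ (P12 _ _ Pg' Ph') (Q12 _ _ Qx' Qy').
have WE : ((PS \x PZ) W = (p n P1 * p n P2) * (mX Q1 * mX Q2))%E.
  transitivity (PS W1 * PZ W2)%E;
    first exact: (product_measure1E PS PZ mW1 mW2).
  congr (_ * _)%E; first exact: (product_measure1E (p n) (p n) mP1 mP2).
  exact: (product_measure1E mX mX mQ1 mQ2).
have : (0 < (p n P1 * p n P2) * (mX Q1 * mX Q2))%E.
  rewrite !mule_gt0//.
  - exact: Sg Pg.
  - exact: Sh Ph.
  - exact: invariant_open_gt0 Qx.
  - exact: invariant_open_gt0 Qy.
by rewrite -WE W0 ltxx.
Qed.

End gap_invariance.

(** * Vanishing of the asymptotic distance *)

Section triviality.
Context (R : realType) (G : topologicalGroupType).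
Hypotheses (sigma_compactG : sigma_compact G) (metG : metrizable R G).
Let scG : @second_countable G :=
  sigma_compact_second_countable metG sigma_compactG.
Context (mu : probability (borel G) R) (Gamma : groupClosed G).
Hypothesis so : spread_out metG mu.
Local Notation X := (coset_space Gamma).
Local Notation act := (@coset_act G Gamma).
Local Notation p := (convolution_power metG mu).
Context (mX : probability (borel X) R) (invX : Defs.invariant act mX).
Context (A : nat -> set (borel X)) (mA : forall j, measurable (A j)).
Local Notation gap := (gap metG mu A).

Let gapT b a c : gap (a, c) <= gap (a, b) + gap (b, c).
Proof. exact: gap_triangle. Qed.
Let gapxx0 a : gap (a, a) = 0.
Proof. exact: gapxx. Qed.
Let gap_ge a b : 0 <= gap (a, b).
Proof. exact: gap_ge0. Qed.
Let gap_sym a b : gap (a, b) = gap (b, a).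
Proof. exact: gapC. Qed.

Lemma gap0_trans b a c : gap (a, b) = 0 -> gap (b, c) = 0 -> gap (a, c) = 0.
Proof.
move=> ab bc; apply/eqP; rewrite eq_le gap_ge andbT.
by apply: le_trans (gapT b a c) _; rewrite ab bc addr0.
Qed.

Definition gap_kernel : set G := [set g | forall z, gap (z, act g z) = 0].

(** For [g] near 1 and [N] large, [p N] and its translate by [g] are too close
    to be singular, so that [h] and [h * g] are both in the support of [p N]
    for some [h]. Then [gap (z, g z) = gap (h z, h g z) = gap (z, z) = 0], by
    [gap_invariant] for the pairs [(h, h)] and [(h, h * g)]. *)
Lemma gap_kernel_nbhs1 : nbhs (1%g : G) gap_kernel.
Proof.
have [|N nearN] := spread_out_equicontinuous (e := 2^-1) sigma_compactG so.
  by rewrite invr_gt0.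
apply: filterS nearN => g /(_ N (leqnn N)) gN.
pose S := msupport (p N).
have mS : measurable (S : set (borel G)) by exact: measurable_msupport.
have [h Sh Shg] : exists2 h, S h & S (h * g)%g.
  apply: contrapT => noh.
  have SC0 : p N (~` S) = 0%E by exact: msupportC0.
  have mSg : measurable ((fun h : G => (h * g)%g) @^-1` S : set (borel G)).
    exact: measurable_preimage_mulgr.
  have : p N ((fun h : G => (h * g)%g) @^-1` S) = 0%E.
    apply: subset_measure0 SC0 => //; first exact: measurableC.
    by move=> h Shg Sh; apply: noh; exists h.
  have := gN (~` S) (measurableC mS).
  rewrite SC0 add0e -preimage_setC probability_setC// => + S0.
  by rewrite S0 sube0 lee_fin; lra.
move=> z.
rewrite -(gap_invariant sigma_compactG so invX mA (n := N) _ _ Sh Sh)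
  -coset_actM.
by rewrite (gap_invariant sigma_compactG so invX mA (n := N) _ _ Sh Shg).
Qed.

Lemma gap_kernelM g h : gap_kernel g -> gap_kernel h -> gap_kernel (g * h)%g.
Proof. by move=> kg kh z; apply: gap0_trans (kh z) _; rewrite coset_actM;
  exact: kg. Qed.

Lemma gap_kernelV g : gap_kernel g -> gap_kernel (g^-1)%g.
Proof. by move=> kg z; rewrite gap_sym -{2}(coset_actVK g z); exact: kg. Qed.

Lemma gap_kernel_subgroup : subgroup gap_kernel.
Proof.
apply: subgroup_intro; [|exact: gap_kernelM|exact: gap_kernelV].
by move=> z; rewrite coset_act1 gapxx0.
Qed.

(** The relation [gap (x, y) = 0] is an equivalence whose classes are open, by
    [gap_kernel_nbhs1]; in a connected space there is only one. *)
Lemma connected_gap0 x y : connected [set: X] -> gap (x, y) = 0.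
Proof.
move=> conX.
pose E := [set y | gap (x, y) = 0].
have nE z : nbhs z [set w | gap (z, w) = 0].
  apply: filterS (nbhs_coset_act z gap_kernel_nbhs1) => _ [g kg <-]; exact: kg.
have oE : open E.
  apply/interior_id/seteqP; split; first exact: interior_subset.
  by move=> z Ez; apply: filterS (nE z) => w; exact: gap0_trans.
have cE : open (~` E).
  apply/interior_id/seteqP; split; first exact: interior_subset.
  move=> z nEz; apply: filterS (nE z) => w zw Ew; apply: nEz.
  by apply: gap0_trans Ew _; rewrite gap_sym.
suff ET : E = [set: X] by have : E y by rewrite ET.
apply: conX.
- by exists x; exact: gapxx0.
- by exists E => //; rewrite setTI.
- by exists E; rewrite ?setTI// -[E]setCK; exact: open_closedC.
Qed.

Hypothesis adaptedmu : adapted mu.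

Lemma adapted_closed_subgroup (K : set G) : subgroup K -> closed K ->
  msupport mu `<=` K -> forall g, K g.
Proof.
move=> sK cK SK g; have : generated_by_support mu g by rewrite adaptedmu.
by apply; split.
Qed.

Lemma msupport_power1 : msupport mu `<=` msupport (p 1).
Proof.
move=> g Sg U oU; have := Sg U oU; congr (_ < _)%E.
have mU : measurable (U : set (borel G)) by apply: open_borel; case: oU.
transitivity (\int[mu]_h p 0 ((fun x : G => (h * x)%g) @^-1` U))%E; last by [].
rewrite -[U in LHS]setIT -integral_indic//.
apply/esym/eq_integral => h _; rewrite /= diracE indicE;
  congr ((nat_of_bool _)%:R%:E).
by apply/idP/idP; rewrite !inE /preimage/= mulg1.
Qed.

Lemma gap_support_invariant g h x y : msupport mu g -> msupport mu h ->
  gap (act g x, act h y) = gap (x, y).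
Proof. by move=> /msupport_power1 Sg /msupport_power1 Sh;
  exact: (gap_invariant sigma_compactG so invX mA _ _ Sg Sh). Qed.

Lemma closed_eq_gap (f g : G -> X * X) : continuous f -> continuous g ->
  closed [set k | gap (f k) = gap (g k)].
Proof.
move=> cf cg; rewrite
  (_ : [set k | _] = (fun k => gap (f k) - gap (g k)) @^-1` [set 0]).
  apply: preimage_closed; last first.
    exact: (accessible_closed_set1 (hausdorff_accessible (@Rhausdorff R))).
  have cgap := gap_continuous sigma_compactG so mA.
  move=> k _; apply: cvgB.
    by apply: (@continuous_comp _ _ _ f gap); [exact: cf|exact: cgap].
  by apply: (@continuous_comp _ _ _ g gap); [exact: cg|exact: cgap].
apply/seteqP; split=> k /= /eqP; first by rewrite -subr_eq0 => /eqP.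
by rewrite subr_eq0 => /eqP.
Qed.

(** The elements of [G] that preserve [gap] form a closed subgroup. It contains
    the support of [mu], by [gap_invariant] for the pair [(g, g)]. *)
Lemma gap_isometry g x y : gap (act g x, act g y) = gap (x, y).
Proof.
pose K := [set k : G | forall z, gap (act k z.1, act k z.2) = gap z].
suff Kg : K g by exact: (Kg (x, y)).
apply: adapted_closed_subgroup.
- apply: subgroup_intro.
  + by move=> [a b]; rewrite !coset_act1.
  + by move=> k l Kk Kl z; rewrite !coset_actM (Kk (_, _)) Kl.
  + by move=> k Kk [a b]; rewrite -(Kk (_, _)) /= !coset_actVK.
- rewrite (_ : K = \bigcap_(z in [set: X * X])
      [set k | gap (act k z.1, act k z.2) = gap z]); last first.
    by apply/seteqP; split=> k Kk z; [move=> _|]; exact: Kk.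
  apply: closed_bigI => z _; apply: closed_eq_gap; last by move=> k;
    exact: cvg_cst.
  have ca w : continuous (fun k : G => act k w).
    by apply: (@continuous_act2 _ _ _ id (fun=> w)) => k;
      [exact: cvg_id|exact: cvg_cst].
  by move=> k; exact: (cvg_pair (ca z.1 k) (ca z.2 k)).
- by move=> s Ss [a b]; exact: gap_support_invariant.
Qed.

(** All elements of the support of [mu] are equal modulo [gap_kernel], by
    [gap_invariant] with [x = y]; in particular they commute modulo it. The
    elements that commute with a given [h'] modulo [gap_kernel] form a closed
    subgroup; it is the whole group as soon as it contains the support. This is
    used first with [h'] in the support, then with [h'] arbitrary. *)
Lemma gap0_commute g h z : gap (act (g * h)%g z, act (h * g)%g z) = 0.
Proof.
have suppeq s t w : msupport mu s -> msupport mu t ->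
  gap (act s w, act t w) = 0.
  by move=> Ss St; rewrite gap_support_invariant.
have central h' : (forall s w, msupport mu s ->
      gap (act (s * h')%g w, act (h' * s)%g w) = 0) ->
    forall k w, gap (act (k * h')%g w, act (h' * k)%g w) = 0.
  move=> comm; pose K :=
    [set k : G | forall w, gap (act (k * h')%g w, act (h' * k)%g w) = 0].
  suff KT : forall k, K k by move=> k; exact: KT.
  apply: adapted_closed_subgroup.
  - apply: subgroup_intro.
    + by move=> w; rewrite mul1g mulg1.
    + move=> k l Kk Kl w; apply: (@gap0_trans (act (k * h' * l)%g w)).
        by rewrite -!mulgA [act (k * _)%g _]coset_actM
          [act (k * (h' * l))%g _]coset_actM gap_isometry.
      by have := Kk (act l w); rewrite -!coset_actM -!mulgA.
    + move=> k Kk w; rewrite gap_sym -(gap_isometry k) -!coset_actM.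
      have := Kk (act k^-1%g w); rewrite -!coset_actM.
      by rewrite !mulgA mulgV mul1g mulgK.
  - rewrite (_ : K = \bigcap_(w in [set: X]) [set k | gap (act (k * h')%g w,
    act (h' * k)%g w) = gap (w, w)]); last first.
      by apply/seteqP; split=> k Kk w;
        [move=> _ /=; rewrite gapxx0|rewrite -(gapxx0 w)]; exact: Kk.
    apply: closed_bigI => w _; apply: closed_eq_gap; last by move=> k;
      exact: cvg_cst.
    have c1 : continuous (fun k : G => (k * h')%g).
      by apply: (@continuous_mulg _ _ id (fun=> h')) => k;
        [exact: cvg_id|exact: cvg_cst].
    have c2 : continuous (fun k : G => (h' * k)%g).
      by apply: (@continuous_mulg _ _ (fun=> h') id) => k;
        [exact: cvg_cst|exact: cvg_id].
    have c3 : continuous (fun _ : G => w) by move=> k; exact: cvg_cst.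
    by move=> k; exact: (cvg_pair (continuous_act2 c1 c3 (x := k))
      (continuous_act2 c2 c3 (x := k))).
  - by move=> s Ss w; exact: comm.
apply: (central h) => s w Ss; rewrite gap_sym; apply: (central s) => t w' St.
apply: (@gap0_trans (act (s * s)%g w')).
  by rewrite !coset_actM; exact: suppeq.
by rewrite !coset_actM gap_isometry; exact: suppeq.
Qed.

(** Otherwise [gap_kernel] would be a proper open normal subgroup, containing
    the commutators by [gap0_commute], with a coset that contains the support
    of [mu]. *)
Lemma aperiodic_gap0 x y : aperiodic mu -> gap (x, y) = 0.
Proof.
move=> aper.
have genT : generated_by_support mu = setT by exact: adaptedmu.
suff HT : gap_kernel = setT.
  have [g <-] := coset_act_transitive x y.
  by have : gap_kernel g by rewrite HT.
apply: contrapT => HnT; apply: aper.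
have muS : mu (msupport mu) = 1%E by exact: msupport1.
have [s Ss] : exists s, msupport mu s.
  apply: contrapT => noS; move: muS; rewrite (_ : msupport mu = set0) ?measure0.
    by move/eqP; rewrite eq_sym onee_eq0.
  by apply/seteqP; split=> // s Ss; apply: noS; exists s.
have oH : open gap_kernel by
  exact: (open_subgroup gap_kernel_subgroup gap_kernel_nbhs1).
exists gap_kernel, s; rewrite genT; split => //.
- split => //; first exact: gap_kernel_subgroup.
  move=> h k Hh _ z; rewrite -(gap_isometry k) -coset_actM.
  by rewrite /conjg mulVKg coset_actM; exact: Hh.
- by exists gap_kernel => //; rewrite setTI.
- apply: smallest_sub; first exact: gap_kernel_subgroup.
  move=> _ [g _ [h _ <-]] z; rewrite -(gap_isometry (h * g)%g) -coset_actM.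
  rewrite (_ : (h * g * [~ g, h] = g * h)%g); first exact: gap0_commute.
  by rewrite /commg /conjg mulgA mulgK mulVKg.
- split => //; apply/eqP; rewrite eq_le.
  have mL : measurable (left_coset s gap_kernel : set (borel G)).
    rewrite (_ : left_coset s gap_kernel = (fun h : G =>
      (s^-1 * h)%g) @^-1` gap_kernel).
      exact: (measurable_preimage_mulgl scG _ (open_borel oH)).
    apply/seteqP; split=> [_ [h Hh <-]|h Hh]; first by rewrite /= mulKg.
    by exists (s^-1 * h)%g => //; rewrite mulVKg.
  rewrite probability_le1//= -muS; apply: le_measure; rewrite ?inE//.
    exact: measurable_msupport.
  move=> t St; exists (s^-1 * t)%g; last by rewrite mulVKg.
  by move=> z; rewrite -(gap_isometry s) -coset_actM mulVKg
    gap_support_invariant.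
Qed.

End triviality.

(** * Total variation and convergence *)

Section total_variation_bound.
Context d (T : measurableType d) (R : realType) (nu : {charge set T -> \bar R})
  (c : R).
Hypothesis nu_le : forall B, measurable B -> (`|nu B| <= c%:E)%E.

Lemma charge_pos_le : (charge_pos nu setT <= c%:E)%E.
Proof.
rewrite -[charge_pos nu _]/(jordan_pos
  (svalP (cid (svalP (cid (Hahn_decomposition nu))))) _).
rewrite jordan_posE cjordan_posE /crestr0 mem_set// /crestr setTI.
apply: le_trans (lee_abs _) (nu_le _).
by case: (svalP (cid (svalP (cid (Hahn_decomposition nu))))) => -[].
Qed.

Lemma charge_neg_le : (charge_neg nu setT <= c%:E)%E.
Proof.
rewrite -[charge_neg nu _]/(jordan_neg
  (svalP (cid (svalP (cid (Hahn_decomposition nu))))) _).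
rewrite jordan_negE cjordan_negE /crestr0 mem_set// /crestr setTI.
apply: le_trans (lee_abs _) _; rewrite abseN; apply: nu_le.
by case: (svalP (cid (svalP (cid (Hahn_decomposition nu))))) => _ -[].
Qed.

Lemma Rintegral_le_mass (m : {finite_measure set T -> \bar R}) (f : T -> R) :
  (m setT <= c%:E)%E -> measurable_fun setT f -> (forall x, `|f x| <= 1) ->
  `|\int[m]_x f x| <= c.
Proof.
move=> mc mf f1.
have fm : m setT \is a fin_num by exact: fin_num_measure.
have int1 : m.-integrable setT (fun=>
  1%E : \bar R) by exact: finite_measure_integrable_cst.
have intf : m.-integrable setT (EFin \o f).
  apply: le_integrable int1 => //; first exact/measurable_EFinP.
  by move=> x _ /=; rewrite lee_fin normr1.
apply: le_trans (le_normr_Rintegral measurableT intf) _.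
apply: (@le_trans _ _ (\int[m]_x (cst 1 x))).
  apply: le_Rintegral => //.
  exact: (integrable_abse intf).
by rewrite Rintegral_cst// mul1r -lee_fin fineK.
Qed.

Lemma charge_integral_le (f : T -> R) :
  measurable_fun setT f -> (forall x, `|f x| <= 1) ->
    `|charge_integral nu f| <= c + c.
Proof.
move=> mf f1; apply: le_trans (ler_normB _ _) _.
by apply: lerD; apply: Rintegral_le_mass => //;
  [exact: charge_pos_le|exact: charge_neg_le].
Qed.

Lemma sqrt_sum_sqr_le (a b : R) : Num.sqrt (a ^+ 2 + b ^+ 2) <= `|a| + `|b|.
Proof.
rewrite -[leRHS]ger0_norm ?addr_ge0// -sqrtr_sqr ler_wsqrtr//.
rewrite sqrrD !real_normK ?num_real// -addrA lerD2l lerDr.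
by rewrite mulrn_wge0// mulr_ge0.
Qed.

(** The real and the imaginary part of the test function are each integrated
    against the positive and the negative part of [nu]: four terms bounded by
    [c]. *)
Lemma tv_norm_le : (tv_norm nu <= (4 * c)%:E)%E.
Proof.
apply: ge_ereal_sup => _ [f [[mRe mIm] f1] <-]; rewrite lee_fin.
have f1' x : Num.sqrt (complex.Re (f x) ^+ 2 + complex.Im (f x) ^+ 2) <= 1.
  by rewrite -lecR -normc_def; exact: f1.
have Re1 x : `|complex.Re (f x)| <= 1.
  by apply: le_trans (f1' x); rewrite -sqrtr_sqr ler_wsqrtr// lerDl sqr_ge0.
have Im1 x : `|complex.Im (f x)| <= 1.
  by apply: le_trans (f1' x); rewrite -sqrtr_sqr ler_wsqrtr// lerDr sqr_ge0.
rewrite normc_def /=; apply: le_trans (sqrt_sum_sqr_le _ _) _.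
have -> : 4 * c = (c + c) + (c + c) by ring.
by apply: lerD; exact: charge_integral_le.
Qed.

End total_variation_bound.

Lemma nearly_maximal_set d (T : measurableType d) (R : realType) (phi : set T ->
    R) :
  (forall B, measurable B -> `|phi B| <= 1) ->
  exists2 A, measurable A & forall B, measurable B -> `|phi B| <= 2 * `|phi A|.
Proof.
move=> phi1; pose S := [set `|phi B| | B in [set B | measurable B]].
have supS : has_sup S.
  split; first by exists `|phi set0|, set0 => //=.
  by exists 1 => _ [B mB <-]; exact: phi1.
have leS B : measurable B -> `|phi B| <= sup S.
  by move=> mB; apply: (ub_le_sup supS.2); exists B.
have [S0|S0] := leP (sup S) 0.
  by exists set0 => // B mB; apply: le_trans (leS B mB) _;
    rewrite (le_trans S0)// mulr_ge0.
have S2 : 0 < sup S / 2 by rewrite divr_gt0.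
have [_ [A mA <-] SA] := sup_adherent S2 supS.
by exists A => // B mB; apply: le_trans (leS B mB) _; lra.
Qed.

Lemma tv_norm_ge0 d (T : measurableType d) (R : realType)
    (nu : {charge set T -> \bar R}) : (0 <= tv_norm nu)%E.
Proof.
apply: (@le_trans _ _ (complex.Re `|charge_cintegral nu (fun=> 0)|)%:E).
  by rewrite lee_fin normc_def sqrtr_ge0.
apply: ereal_sup_ubound; exists (fun=> 0) => //; split; first by split;
  exact: measurable_cst.
by move=> x; rewrite normr0.
Qed.

Theorem corollary1p5 (R : realType) (G : topologicalGroupType)
    (sigma_compactG : sigma_compact G)
    (locally_compactG : locally_compact [set: G])
    (metG : metrizable R G)
    (Gamma : groupClosed G) (latticeGamma : is_lattice R Gamma)
    (mu : probability (borel G) R) (spread_out_mu : spread_out metG mu)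
    (connected_or_aperiodic :
      connected [set: coset_space Gamma] \/ (adapted mu /\ aperiodic mu))
    (mX : probability (borel (coset_space Gamma)) R)
    (haar_mX : normalized_haar mX)
    (x0 : coset_space Gamma) :
  (fun n : nat =>
     tv_norm (charge_diff
       (convolution metG (@coset_act_continuous G Gamma)
          (convolution_power metG mu n) (dirac (x0 : borel (coset_space Gamma))))
       mX)) @ \oo --> 0%E.
Proof.
have scG := sigma_compact_second_countable metG sigma_compactG.
have [_ invX] := haar_mX.
pose p := convolution_power metG mu.
pose P n := convolution metG (@coset_act_continuous G Gamma) (p n)
  (dirac (x0 : borel (coset_space Gamma))).
have PE n B : measurable B -> P n B = (hit metG mu n B x0)%:E.
  move=> mB; rewrite hitE//; pose C : set (borel G) :=
    [set g | B (coset_act g x0)].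
  transitivity (\int[p n]_g (\1_C g)%:E)%E; last first.
    by rewrite integral_indic ?setIT//; exact: measurable_return.
  apply: eq_integral => g _; rewrite /= diracE indicE.
  by congr ((nat_of_bool _)%:R%:E); apply/idP/idP; rewrite !inE.
have PEf n B : measurable B -> fine (P n B) = hit metG mu n B x0 by move=>
  /(PE n) ->.
(* The measure [mX] is stationary for the walk. *)
have hit_mean n B : measurable B ->
  (\int[mX]_y (hit metG mu n B y)%:E = mX B)%E.
  move=> mB; pose C :=
    [set z : borel (coset_space Gamma) * borel G | B (coset_act z.2 z.1)].
  have mC : measurable C.
    suff mf : measurable_fun setT
      (fun z : borel (coset_space Gamma) * borel G =>
        coset_act z.2 z.1 : borel (coset_space Gamma)).
      exact: (measurable_preimage mf mB).
    exact: measurable_act.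
  transitivity (\int[mX]_y p n [set g | C (y, g)])%E.
    by apply: eq_integral => y _; rewrite hitE.
  rewrite (fubini_section mX (p n) mC).
  transitivity (\int[p n]_g mX B)%E;
    last exact: (integral_cst_probability (p n) (mX B)).
  by apply: eq_integral => g _; exact: invX.
pose phi n B := fine (P n B) - fine (mX B).
have phi1 n B : measurable B -> `|phi n B| <= 1.
  move=> mB; have P1 : fine (P n B) <= 1.
    by rewrite -lee_fin fineK ?probability_le1//; exact: fin_num_measure.
  have m1 : fine (mX B) <= 1.
    by rewrite -lee_fin fineK ?probability_le1//; exact: fin_num_measure.
  have P0 : 0 <= fine (P n B) by exact: fine_ge0.
  have m0 : 0 <= fine (mX B) by exact: fine_ge0.
  by rewrite /phi ler_norml; lra.
(* The sequence of sets with respect to which [gap] is computed. *)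
have /choice[A /= AP] n : exists A, measurable A /\
    forall B, measurable B -> `|phi n B| <= 2 * `|phi n A|.
  by have [A mA AP] := nearly_maximal_set (phi1 n); exists A.
have mA n : measurable (A n) by case: (AP n).
have gap0 y : gap metG mu A (x0, y) = 0.
  case: connected_or_aperiodic => [conX|[adapt aper]].
    exact: (connected_gap0 sigma_compactG spread_out_mu invX mA x0 y conX).
  exact: (aperiodic_gap0 sigma_compactG spread_out_mu invX mA adapt x0 y aper).
pose t n (y : borel (coset_space Gamma)) := tail_gap metG mu A n (x0, y).
have mt n : measurable_fun setT (t n).
  exact: (measurableT_comp (measurable_tail_gap sigma_compactG metG mu mA n)
    (pair1_measurable (x0 : borel (coset_space Gamma)))).
have cvt : (\int[mX]_y (t n y)%:E)%E @[n --> \oo] --> 0%E.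
  have := bounded_cvg_integral (P := mX) (f_ := t) (f := fun=> 0) mt.
  rewrite integral0; apply.
    by move=> n y; rewrite /t tail_gap_ge0 ?tail_gap_le1.
  by move=> y; rewrite -(gap0 y); exact: tail_gap_cvg.
have le n : (`|phi n (A n)|%:E <= \int[mX]_y (t n y)%:E)%E.
  rewrite /phi PEf//.
  apply: (@dist_integral_le _ _ _ mX (fun=> hit metG mu n (A n) x0)
    (hit metG mu n (A n)) (t n)) => //.
  - exact: measurable_hit.
  - by move=> y; exact: hit_ge0.
  - by move=> y; exact: hit_ge0.
  - by move=> y; exact: (hit_gap_le_tail sigma_compactG metG mu mA n (x0,
    y) (leqnn n)).
  - exact: (integral_cst_probability mX (hit metG mu n (A n) x0)%:E).
  - by rewrite hit_mean// fineK//; exact: fin_num_measure.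
have tv n : (tv_norm (charge_diff (P n) mX) <= 8%:E * \int[mX]_y (t n y)%:E)%E.
  apply: (@le_trans _ _ (8%:E * `|phi n (A n)|%:E)%E); last first.
    by apply: lee_wpmul2l; rewrite ?lee_fin.
  rewrite -EFinM (_ : 8 * _ = 4 * (2 * `|phi n (A n)|)); last by ring.
  apply: tv_norm_le => B mB.
  rewrite -[charge_diff _ _ B]/(P n B - mX B)%E.
  rewrite -(fineK (fin_num_measure (P n) B mB))
    -(fineK (fin_num_measure mX B mB)).
  by rewrite -EFinB abse_EFin lee_fin; case: (AP n) => _; apply.
apply: (@squeeze_cvge _ _ _ _ (cst 0%E) _ (fun n =>
  8%:E * \int[mX]_y (t n y)%:E)%E).
- apply: nearW => n; rewrite tv andbT.
  exact: tv_norm_ge0.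
- exact: cvg_cst.
- rewrite -[X in _ --> X](mule0 8%:E); apply: cvgeZl => //.
Qed.
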